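(* Let $A \subset \mathbb{F}_q\setminus\{0\}$ with $|A|\ge 2$. Suppose that there exists some $\delta >0$ such that \[ |A \cap (cG + d)| \ll \max\{|G|^{1/2}, |A|^{1-\delta}\} \] for all proper subfields $G$ of $\mathbb{F}_q$ and all elements $c, d \in \mathbb{F}_q$. Then \[ T(A) \ll \log|A| \cdot \max\big\{|A + A|^{7/4}|A|^{3},\ |A + A|^{6/5}|A|^{18/5},\ |A|^{5-\delta/2},\ |A + A|^{7/4}|A|^{7/2}q^{-1/4} \big\}. \] The same estimate holds with the sum set $A + A$ replaced by the difference set $A -A$.
   Context: $q$ is a power of a prime and $\mathbb{F}_q$ is the finite field with $q$ elements. $T(A)$ is the number of sextuples $(a_1,a_2,a_3,b_1,b_2,b_3)\in A^6$ with $(a_2-a_1)(b_3-b_1)=(a_3-a_1)(b_2-b_1)$. $A\pm A=\{a\pm b: a,b\in A\}$ and $cG+d=\{cg+d: g\in G\}$. $X\ll Y$ means $X\le CY$ for an absolute constant $C>0$; the hypothesis is assumed with some fixed absolute constant, uniformly in $G,c,d$, and the implied constant in the conclusion may depend on that constant only. *)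

(* Defs.v *)
From mathcomp Require Import all_boot all_order all_algebra.
From mathcomp Require Import reals exp.

Set Implicit Arguments.
Unset Strict Implicit.
Unset Printing Implicit Defensive.

Import Order.TTheory GRing.Theory Num.Theory.
Local Open Scope ring_scope.

Definition collinear_sextuples (F : finFieldType) (A : {set F}) : nat :=
  #|[set t : (F * F * F) * (F * F * F) |
      let: ((a1, a2, a3), (b1, b2, b3)) := t in
      [&& a1 \in A, a2 \in A, a3 \in A, b1 \in A, b2 \in A, b3 \in A
        & (a2 - a1) * (b3 - b1) == (a3 - a1) * (b2 - b1)]]|.

Definition sumset (F : finFieldType) (A : {set F}) : {set F} :=
  [set a + b | a in A, b in A].

Definition diffset (F : finFieldType) (A : {set F}) : {set F} :=
  [set a - b | a in A, b in A].

Definition affine_image (F : finFieldType) (c d : F) (G : {set F}) : {set F} :=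
  [set c * g + d | g in G].

(* In a field, [divring_closed] (contains 1, closed under x - y and x / y)
   is being a subfield, since 0^-1 = 0. *)
Definition proper_subfield (F : finFieldType) (G : {set F}) : Prop :=
  GRing.divring_closed G /\ G \proper [set: F].

Definition subfield_condition (R : realType) (F : finFieldType)
    (K delta : R) (A : {set F}) : Prop :=
  forall (G : {set F}) (c d : F), proper_subfield G ->
    #|A :&: affine_image c d G|%:R
      <= K * Num.max (#|G|%:R `^ (1 / 2)) (#|A|%:R `^ (1 - delta)).

(* S stands for A + A or A - A. *)
Definition collinear_bound (R : realType) (F : finFieldType)
    (delta : R) (A S : {set F}) : R :=
  let a : R := #|A|%:R in
  let s : R := #|S|%:R in
  let q : R := #|F|%:R in
  ln a *
  Num.max (Num.max (s `^ (7 / 4) * a ^+ 3)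
                   (s `^ (6 / 5) * a `^ (18 / 5)))
          (Num.max (a `^ (5 - delta / 2))
                   (s `^ (7 / 4) * a `^ (7 / 2) * q `^ (- (1 / 4)))).

(* Main.v *)
Require Import Defs.
From mathcomp Require Import all_boot all_order all_algebra.
From mathcomp Require Import reals exp.
From mathcomp Require Import zify ring lra.

Import Order.TTheory GRing.Theory Num.Theory.
Local Open Scope ring_scope.

Set Implicit Arguments.
Unset Strict Implicit.
Unset Printing Implicit Defensive.

(** Let s be the size of A + eps A with eps = 1 or eps = -1, so that sums and
differences are one case, and suppose that T, the number of collinear triples
of points of A x A, is large.

A dyadic choice of lines and an averaged choice of a base point p in the grid
give a set D of slopes such that every line of slope xi in D through p holds
about N grid points.  A rich slope xi is cheap: it carries N elements of A into
a translate of A, so in a sum of dilates the term xi B can be replaced, at the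
cost of a factor s / N, by a piece of a translate of A ([cover_dilate], a form
of the Ruzsa triangle inequality with both signs).  Four replacements bound B + z B'
for every z = (a - b) / (c - d) with a, b, c, d in D ([card_ratio_sum_le]).
On the other hand, if z is not a quotient of differences of B and of B', then
B + z B' has the maximal size |B| |B'| ([card_unique_sums]).  Hence the set R
of quotients of differences of D is contained in the set of quotients of
differences of any two large subsets of the grid sides.

This rigidity gives R algebraic structure ([many_points_force_subfield]).
The slopes from p to the points above an abscissa u are the ordinates divided
by u; writing z in R with a numerator from the points above u and a denominator
from those above u' shows that R is stable under multiplication by u' / u.  And
R is stable under z |-> z + eps: otherwise z + eps has unique sums on suitable
sets, which Petridis's lemma and three replacements refute
([shifted_ratio_bound]); the fourth slope needs no replacement because one of
the two sets is chosen inside its line.  The stabiliser of the translations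
that stabilise R is then a subfield G contained in R, and a coset of a dilate
of G contains a set V of popular abscissas ([stabilizer_field]).  A second
moment computation finds r in G such that V + r V is almost as large as
min (|V|^2, |G|) ([few_collisions]), and r lies in R, so V + r V is small.  If
G is the whole field, this gives the term with q; if G is proper, the
hypothesis on A bounds V by a multiple of |G|^(1/2), which again contradicts
that V + r V is small, or by a multiple of |A|^(1-delta), which is the third
term.

The exponent 7/4 requires that the four pieces which remain after the
replacements have a sum of size s^3 / |A|^2, whereas Pluennecke's inequality
gives s^4 / |A|^3 for A itself.  The smaller bound holds for a set built from
minimisers in Petridis's lemma, which exhaust all but a small proportion of a
given set ([special_subset]).  To lose no triples when passing to it, the
square grid A x A is first replaced by a grid X x Y that maximises
T(X, Y)^2 / (|X| |Y|)^3: by maximality, thin subgrids carry few triples, and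
the normalisation is the one that the final inequality requires
([special_pair]). *)

(** * Sums and dilates of finite sets *)

Section Sumsets.
Variable F : finFieldType.
Implicit Types (A B C W X Y Z S : {set F}) (c d t : F).

Definition addset A B : {set F} := [set a + b | a in A, b in B].
Definition dil c A : {set F} := [set c * a | a in A].

Lemma mem_addset A B a b : a \in A -> b \in B -> a + b \in addset A B.
Proof. by move=> aA bB; apply/imset2P; exists a b. Qed.

Lemma mem_dil c A a : a \in A -> c * a \in dil c A.
Proof. exact: imset_f. Qed.

Lemma addsetC A B : addset A B = addset B A.
Proof.
by apply/setP=> z; apply/imset2P/imset2P=> -[a b aA bB ->]; exists b a; rewrite // addrC.
Qed.

Lemma addsetA A B C : addset A (addset B C) = addset (addset A B) C.
Proof.
apply/setP=> z; apply/imset2P/imset2P.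
  move=> [a _ aA /imset2P[b c bB cC ->] ->].
  by exists (a + b) c; rewrite ?addrA // mem_addset.
move=> [_ c /imset2P[a b aA bB ->] cC ->].
by exists a (b + c); rewrite ?addrA // mem_addset.
Qed.

Lemma addsetAC A B C : addset (addset A B) C = addset (addset A C) B.
Proof. by rewrite -!addsetA (addsetC B). Qed.

Lemma addsetS A A' B B' : A \subset A' -> B \subset B' -> addset A B \subset addset A' B'.
Proof. exact: imset2S. Qed.

Lemma card_addset1 A t : #|addset A [set t]| = #|A|.
Proof.
have -> : addset A [set t] = [set a + t | a in A].
  apply/setP=> z; apply/imset2P/imsetP => [[a b aA /set1P -> ->]|[a aA ->]].
    by exists a.
  by exists a t; rewrite ?set11.
by rewrite card_imset //; apply: addIr.
Qed.

Lemma addset0 A : addset A set0 = set0.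
Proof. by apply/setP=> z; rewrite inE; apply/imset2P=> -[a b _]; rewrite inE. Qed.

Lemma add0set A : addset set0 A = set0.
Proof. by rewrite addsetC addset0. Qed.

Lemma addsetU A B C : addset A (B :|: C) = addset A B :|: addset A C.
Proof.
apply/setP=> z; rewrite inE; apply/imset2P/orP.
  by move=> [a b aA /setUP[bB|bC] ->]; [left|right]; apply: mem_addset.
by case=> /imset2P[a b aA bB ->]; exists a b; rewrite // inE bB ?orbT.
Qed.

Lemma addsetUl A B C : addset (A :|: B) C = addset A C :|: addset B C.
Proof. by rewrite addsetC addsetU !(addsetC C). Qed.

Lemma leq_card_addsetl A B : B != set0 -> (#|A| <= #|addset A B|)%N.
Proof.
case/set0Pn=> b bB; rewrite -(card_addset1 A b); apply: subset_leq_card.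
by apply: addsetS; rewrite ?sub1set.
Qed.

Lemma dil_add c A B : dil c (addset A B) = addset (dil c A) (dil c B).
Proof.
apply/setP=> z; apply/imsetP/imset2P.
  move=> [_ /imset2P[a b aA bB ->] ->]; exists (c * a) (c * b); rewrite ?mem_dil //.
  by rewrite mulrDr.
move=> [_ _ /imsetP[a aA ->] /imsetP[b bB ->] ->]; exists (a + b); rewrite ?mem_addset //.
by rewrite mulrDr.
Qed.

Lemma dil_dil c d A : dil c (dil d A) = dil (c * d) A.
Proof. by rewrite /dil -imset_comp; apply: eq_imset => a /=; rewrite mulrA. Qed.

Lemma dil1 A : dil 1 A = A.
Proof. by rewrite /dil (eq_imset (g := id)) ?imset_id // => a; rewrite mul1r. Qed.

Lemma dilS c A B : A \subset B -> dil c A \subset dil c B.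
Proof. exact: imsetS. Qed.

Lemma card_dil c A : c != 0 -> #|dil c A| = #|A|.
Proof. by move=> c0; rewrite card_imset //; apply: mulfI. Qed.

Lemma card_dil_le c A : (#|dil c A| <= #|A|)%N.
Proof. exact: leq_imset_card. Qed.

Lemma dil_subset_add c d A : dil (c + d) A \subset addset (dil c A) (dil d A).
Proof.
by apply/subsetP=> _ /imsetP[a aA ->]; rewrite mulrDl mem_addset ?mem_dil.
Qed.

Definition petridis_min X A := forall X', X' \subset X ->
  (#|addset X A| * #|X'| <= #|addset X' A| * #|X|)%N.

(** Petridis's lemma.  Adding the elements c of C one at a time, the new part of
X + A + c misses X' + A + c, where X' is the set of x with x + A + c already
covered; minimality applied to X' compares this saving with the one in X + C. *)
Lemma petridis X A C : petridis_min X A ->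
  (#|addset (addset X A) C| * #|X| <= #|addset X A| * #|addset X C|)%N.
Proof.
move=> minX; have [n] := ubnP #|C|; elim: n C => // n IHn C leCn.
have [->|/set0Pn[c cC]] := eqVneq C set0; first by rewrite !addset0 !cards0 muln0.
pose C' := C :\ c; have defC : C = [set c] :|: C' by rewrite setD1K.
have {}IHn : (#|addset (addset X A) C'| * #|X| <= #|addset X A| * #|addset X C'|)%N.
  by apply: IHn; rewrite (cardsD1 c C) cC in leCn.
pose S' := addset (addset X A) C'; pose T := addset (addset X A) [set c].
pose X' := [set x in X | addset (addset [set x] A) [set c] \subset S'].
pose X'' := [set x in X | x + c \in addset X C'].
have sX'X : X' \subset X by apply/subsetP=> x; rewrite inE => /andP[].
have sX''X' : X'' \subset X'.
  apply/subsetP=> x; rewrite !inE => /andP[-> /imset2P[x2 c2 x2X c2C' xc]] /=.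
  apply/subsetP=> _ /imset2P[_ _ /imset2P[_ a /set1P-> aA ->] /set1P -> ->].
  by rewrite addrAC xc addrAC; do !apply: mem_addset.
have sX''X : X'' \subset X by apply: subset_trans sX'X.
have cardT : #|T| = #|addset X A| by rewrite card_addset1.
have leA : (#|addset (addset X A) C| <= #|S'| + (#|addset X A| - #|addset X' A|))%N.
  rewrite defC addsetU -/T -/S' setUC -(setID T S') setUA.
  have -> : S' :|: T :&: S' = S' by apply/setUidPl/subsetIr.
  apply: leq_trans (leq_card_setU _ _) _; rewrite leq_add2l cardsD cardT leq_sub2l //.
  rewrite -(card_addset1 (addset X' A) c); apply: subset_leq_card.
  apply/subsetP=> _ /imset2P[_ _ /imset2P[x a xX' aA ->] /set1P -> ->].
  rewrite inE; apply/andP; split.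
    by do !apply: mem_addset; rewrite ?set11 //; apply: (subsetP sX'X).
  move: xX'; rewrite inE => /andP[_ /subsetP]; apply.
  by do !apply: mem_addset; rewrite ?set11.
have eqB : #|addset X C| = (#|addset X C'| + (#|X| - #|X''|))%N.
  rewrite defC addsetU setUC -(setID (addset X [set c]) (addset X C')) setUA.
  have -> : addset X C' :|: addset X [set c] :&: addset X C' = addset X C'.
    by apply/setUidPl/subsetIr.
  rewrite cardsU; have -> : addset X C' :&: (addset X [set c] :\: addset X C') = set0.
    by apply/setP=> z; rewrite !inE; case: (z \in addset X C').
  rewrite cards0 subn0 cardsD card_addset1; congr (_ + (_ - _))%N.
  rewrite -(card_addset1 X'' c); apply: eq_card => z; rewrite inE.
  apply/andP/imset2P.
    by move=> [/imset2P[x _ xX /set1P-> zxc] zC]; exists x c; rewrite ?set11 // inE xX -zxc.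
  move=> [x _ + /set1P -> ->]; rewrite inE => /andP[xX xc]; split => //.
  by apply: mem_addset; rewrite ?set11.
have leX'' := subset_leq_card sX''X; have leX''' := subset_leq_card sX''X'.
have := minX _ sX'X; have leK : (#|addset X' A| <= #|addset X A|)%N.
  by apply/subset_leq_card/addsetS.
rewrite -/S' in IHn.
move: leA eqB leX'' leX''' leK IHn.
move: #|addset (addset X A) C| #|addset X C| #|S'| #|addset X A| #|addset X' A| #|addset X C'| #|X| #|X'| #|X''|.
by move=> *; nia.
Qed.

Lemma petridis_min_exists U A : U != set0 ->
  exists X, [/\ X \subset U, X != set0, petridis_min X A
    & (#|addset X A| * #|U| <= #|addset U A| * #|X|)%N].
Proof.
move=> U0.
pose f (X : {set F}) : rat := #|addset X A|%:R / #|X|%:R.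
have PU : (U \subset U) && (U != set0) by rewrite subxx.
case: (@Order.TotalTheory.arg_minP _ _ _ U (fun X => (X \subset U) && (X != set0)) f PU) => X.
move=> /andP[sXU X0] minX; exists X.
have key X' : X' \subset U -> (#|addset X A| * #|X'| <= #|addset X' A| * #|X|)%N.
  move=> sX'; have [->|X'0] := eqVneq X' set0; first by rewrite cards0 muln0.
  have := minX X'; rewrite sX' X'0 => /(_ isT).
  rewrite /f ler_pdivrMr ?ltr0n ?card_gt0 // mulrAC ler_pdivlMr ?ltr0n ?card_gt0 //.
  by rewrite -!natrM ler_nat.
split=> //; last exact: key.
by move=> X' sX'; apply: key; apply: subset_trans sXU.
Qed.

(** The triangle inequality for sums: a minimiser X inside B turns the growth of
X + A + C into that of X + C, and A + C embeds into X + A + C. *)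
Lemma ruzsa_sum A B C : (#|B| * #|addset A C| <= #|addset A B| * #|addset B C|)%N.
Proof.
have [->|B0] := eqVneq B set0; first by rewrite cards0.
have [X [sXB X0 minX leX]] := petridis_min_exists A B0.
have le1 := petridis C minX.
have le2 : (#|addset A C| <= #|addset (addset X A) C|)%N.
  by rewrite -addsetA (addsetC X); apply: leq_card_addsetl.
have le3 : (#|addset X C| <= #|addset B C|)%N by apply/subset_leq_card/addsetS.
have X_gt0 : (0 < #|X|)%N by rewrite card_gt0.
rewrite (addsetC A B).
rewrite -(leq_pmul2l X_gt0).
apply: (@leq_trans (#|B| * (#|addset X A| * #|addset X C|))).
  by rewrite mulnCA leq_mul2l; apply/orP; right; apply: leq_trans le1; rewrite mulnC leq_mul2r le2 orbT.
rewrite mulnA (mulnC #|B|) mulnA (mulnC #|X|); exact: leq_mul.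
Qed.

(** Ruzsa's injection: (b, a + c) determines the pair (a - b, b + c), and is
recovered from it because the two entries add up to a + c. *)
Lemma ruzsa_diff A B C :
  (#|B| * #|addset A C| <= #|addset A (dil (-1)%R B)| * #|addset B C|)%N.
Proof.
(* a choice of summands for each element of A + C *)
pose rep z := odflt (0, 0) [pick w : F * F | [&& w.1 \in A, w.2 \in C & z == w.1 + w.2]].
have repP z : z \in addset A C -> [/\ (rep z).1 \in A, (rep z).2 \in C & z = (rep z).1 + (rep z).2].
  move=> /imset2P[a c aA cC zE]; rewrite /rep; case: pickP => [w /and3P[? ? /eqP]|] //=.
  by move/(_ (a, c)); rewrite /= aA cC zE eqxx.
pose f (w : F * F) := ((rep w.2).1 + (-1) * w.1, w.1 + (rep w.2).2).
rewrite -!cardsX -(@card_in_imset _ _ f).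
  apply: subset_leq_card; apply/subsetP=> _ /imsetP[[b z] /setXP[bB zAC] ->] /=.
  by have [? ? _] := repP z zAC; rewrite inE /= !mem_addset ?mem_dil.
move=> [b z] [b' z'] /setXP[/= bB zAC] /setXP[/= bB' zAC'] [].
have [_ _ zE] := repP z zAC; have [_ _ zE'] := repP z' zAC' => e1 e2.
have zz : z = z'.
  rewrite zE zE'; have : (rep z).1 + -1 * b + (b + (rep z).2) =
    (rep z').1 + -1 * b' + (b' + (rep z').2) by rewrite e1 e2.
  by rewrite !mulN1r !addrA !addrNK.
by subst z'; move/addIr: e2 => ->.
Qed.

(** Replacing k B by a dilate of W in a sum.  The two triangle inequalities allow
both signs tau, whichever of W + B and W - B is the small set; the free sign is
what lets all remaining pieces be given the same orientation. *)
Lemma cover_dilate eps tau k B W Z : eps ^+ 2 = 1 -> tau ^+ 2 = 1 ->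
  (#|W| * #|addset (dil k B) Z| <= #|addset B (dil eps W)| * #|addset (dil (tau * k)%R W) Z|)%N.
Proof.
have sq (e : F) : e ^+ 2 = 1 -> e = 1 \/ e = -1.
  by move=> /eqP; rewrite sqrf_eq1 => /orP[] /eqP; auto.
move=> e2 t2; have eps0 : eps != 0 by case: (sq _ e2) => ->; rewrite ?oppr_eq0 oner_eq0.
have [->|k0] := eqVneq k 0.
  rewrite mulr0; have [->|W0] := eqVneq W set0; first by rewrite cards0.
  have [->|B0] := eqVneq B set0; first by rewrite /dil imset0 addsetC addset0 cards0 muln0.
  have dil0 (A : {set F}) : A != set0 -> dil 0 A = [set 0].
    move=> /set0Pn[a aA]; apply/setP=> z; rewrite inE; apply/imsetP/eqP.
      by move=> [b _ ->]; rewrite mul0r.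
    by move=> ->; exists a; rewrite ?mul0r.
  rewrite !dil0 // leq_mul2r; apply/orP; right.
  by rewrite -(card_dil W eps0) addsetC; apply: leq_card_addsetl.
have tk0 : tau * k != 0.
  by rewrite mulf_neq0 //; case: (sq _ t2) => ->; rewrite ?oppr_eq0 oner_eq0.
have le_s e : (#|addset (dil k B) (dil (e * k)%R W)| <= #|addset B (dil e W)|)%N.
  by rewrite mulrC -dil_dil -dil_add card_dil_le.
rewrite -(card_dil W tk0).
have [tE|tE] : tau = eps \/ tau = - eps.
  by case: (sq _ e2) => ->; case: (sq _ t2) => ->; rewrite ?opprK; auto.
  apply: leq_trans (ruzsa_sum _ _ _) _; rewrite leq_mul2r; apply/orP; right.
  by rewrite tE.
apply: leq_trans (ruzsa_diff _ _ _) _; rewrite leq_mul2r; apply/orP; right.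
by rewrite dil_dil tE mulrA mulN1r opprK.
Qed.
End Sumsets.

(** * Subsets with small iterated sums *)

Section Special.
Variable F : finFieldType.
Implicit Types (A B C W X Y Z S U : {set F}) (c d t : F).

Lemma petridis3 X E : X != set0 -> petridis_min X E ->
  (#|addset (addset (addset X E) E) E| * #|X| ^ 2 <= #|addset X E| ^ 3)%N.
Proof.
move=> X0 minX.
have := petridis (addset E E) minX; have := petridis E minX.
rewrite !addsetA; move: #|addset (addset (addset X E) E) E| #|addset (addset X E) E| => a b.
by move: #|X| #|addset X E| => x k; nia.
Qed.

(** Each minimiser removed from X has, by three applications of Petridis's lemma,
iterated sums governed by the cube of its own ratio, which stays below
k s / |X| as long as more than |X| / k elements remain. *)
Lemma special_subset X E k s : (0 < k)%N -> (#|addset X E| <= s)%N ->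
  exists X', [/\ X' \subset X, (k * #|X :\: X'| <= #|X|)%N
   & (#|addset (addset (addset X' E) E) E| * #|X| ^ 3 <= (k * s) ^ 3 * #|X'|)%N].
Proof.
move=> k0 les.
suff H n U : (#|U| < n)%N -> U \subset X ->
  exists X', [/\ X' \subset U, (k * #|U :\: X'| <= #|X|)%N
   & (#|addset (addset (addset X' E) E) E| * #|X| ^ 3 <= (k * s) ^ 3 * #|X'|)%N].
  by have [//|X' [? ? ?]] := H _ X (ltnSn _); exists X'.
elim: n U => // n IHn U leU sUX.
have [leUk|ltUk] := leqP (k * #|U|) #|X|.
  exists set0; rewrite sub0set setD0; split=> //.
  by rewrite !add0set cards0.
have U0 : U != set0 by rewrite -card_gt0; case: #|U| ltUk => //; rewrite muln0.
have [X1 [sX1U X10 minX1 leX1]] := petridis_min_exists E U0.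
have X1_gt0 : (0 < #|X1|)%N by rewrite card_gt0.
have cardD : #|U :\: X1| = (#|U| - #|X1|)%N by rewrite cardsD (setIidPr sX1U).
have leX1U := subset_leq_card sX1U.
have [||X2 [sX2 leX2 boundX2]] := IHn (U :\: X1).
- by rewrite cardD; lia.
- by apply: subset_trans sUX; apply: subsetDl.
exists (X1 :|: X2); split.
- by rewrite subUset sX1U (subset_trans sX2) // subsetDl.
- by rewrite -setDDl.
- have disj : #|X1 :|: X2| = (#|X1| + #|X2|)%N.
    rewrite cardsU; suff -> : X1 :&: X2 = set0 by rewrite cards0 subn0.
    apply/setP=> z; rewrite !inE; apply/negP=> /andP[zX1 /(subsetP sX2)].
    by rewrite !inE zX1.
  rewrite disj !addsetUl mulnDr.
  apply: leq_trans (leq_mul (leq_card_setU _ _) (leqnn _)) _; rewrite mulnDl.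
  apply: leq_add => //.
  have leUX : (#|addset U E| <= s)%N.
    by apply: leq_trans les; apply/subset_leq_card/addsetS.
  have P3 := petridis3 X10 minX1.
  have e1 : (#|addset X1 E| * #|U| <= s * #|X1|)%N.
    by apply: leq_trans leX1 _; rewrite leq_mul2r leUX orbT.
  have e2 : ((#|addset X1 E| * #|U|) ^ 3 <= (s * #|X1|) ^ 3)%N by rewrite leq_exp2r.
  rewrite !expnMn in e2.
  have e3 : (#|X| ^ 3 <= k ^ 3 * #|U| ^ 3)%N by rewrite -expnMn leq_exp2r // ltnW.
  rewrite -(leq_pmul2r (_ : 0 < #|X1| ^ 2)%N) ?expn_gt0 ?X1_gt0 //.
  set Q := #|addset (addset (addset X1 E) E) E| in P3 *.
  apply: (@leq_trans (#|addset X1 E| ^ 3 * (k ^ 3 * #|U| ^ 3))).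
    by rewrite mulnAC; apply: leq_mul.
  rewrite expnMn mulnCA.
  have -> : (k ^ 3 * s ^ 3 * #|X1| * #|X1| ^ 2 = k ^ 3 * (s ^ 3 * #|X1| ^ 3))%N.
    by rewrite (expnS #|X1| 2) !mulnA.
  by rewrite leq_mul2l e2 orbT.
Qed.
End Special.

(** * Collinear triples in a grid *)

Section Lines.
Variable F : finFieldType.
Implicit Types (A B C W X Y Z S U : {set F}) (c d t : F) (l : F * F).

(** A pair l stands for the line with slope [l.1] and intercept [l.2]. *)
Definition on_line l X Y : {set F} := [set u in X | l.1 * u + l.2 \in Y].
Definition line_count X Y l := #|on_line l X Y|.
(** Lines with one point are discarded: there are about q of them through each
point, and they would swamp the count. *)
Definition line_weight (n : nat) := ((1 < n) * n ^ 3)%N.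
Definition collinear_triples X Y := (\sum_(l : F * F | l.1 != 0%R) line_weight (line_count X Y l))%N.

Lemma line_count_le X Y l : (line_count X Y l <= #|X|)%N.
Proof. by apply/subset_leq_card/subsetP=> u; rewrite inE => /andP[]. Qed.

(** Two points with distinct abscissas lie on one line. *)
Lemma sum_line_pairs X Y :
  (\sum_(l : F * F | l.1 != 0%R) line_count X Y l * (line_count X Y l).-1 <= (#|X| * #|Y|) ^ 2)%N.
Proof.
pose b l u := l.1 * u + l.2 \in Y.
have E l : (line_count X Y l * (line_count X Y l).-1 =
   \sum_(u in X) \sum_(v in X | v != u) (b l u && b l v))%N.
  transitivity (\sum_(u in on_line l X Y) #|on_line l X Y :\ u|)%N.
    rewrite (eq_bigr (fun _ => (line_count X Y l).-1)) ?sum_nat_const //.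
    by move=> u uR; rewrite /line_count (cardsD1 u (on_line l X Y)) uR.
  rewrite (eq_bigl (fun u => (u \in X) && b l u)); last by move=> u; rewrite inE.
  rewrite big_mkcondr; apply: eq_bigr => u uX; case: (b l u) => /=.
    rewrite -sum1_card big_mkcond [in RHS]big_mkcond; apply: eq_bigr => v _.
    by rewrite !inE /b; case: (v \in X); case: (v == u) => //=; case: (_ \in Y).
  by rewrite big1.
under eq_bigr => l _ do rewrite E.
rewrite exchange_big /=.
apply: (@leq_trans (\sum_(u in X) \sum_(v in X) #|Y| ^ 2)%N); last first.
  by rewrite !sum_nat_const mulnA mulnn expnMn.
apply: leq_sum => u uX; rewrite exchange_big /=.
rewrite [X in (_ <= X)%N](bigID (fun v => v != u)) /=; apply: leq_trans (leq_addr _ _).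
apply: leq_sum => v /andP[vX vu].
rewrite -big_mkcondr sum1_card -[X in (_ <= X)%N]mulnn -cardsX.
pose f l := (l.1 * u + l.2, l.1 * v + l.2).
rewrite -(@card_in_image _ _ f).
  apply: subset_leq_card; apply/subsetP=> _ /imageP[l + ->].
  by rewrite !inE /b => /and3P[_ ? ?]; rewrite /f /=; apply/andP.
move=> [x1 t1] [x2 t2] _ _ [] /= e1 e2.
have ex : (x1 - x2) * (v - u) = 0.
  have -> : (x1 - x2) * (v - u) = (x1 * v + t1 - (x1 * u + t1)) - (x2 * v + t2 - (x2 * u + t2)) by ring.
  by rewrite e1 e2 subrr.
have xx : x1 = x2.
  by apply/eqP; move/eqP: ex; rewrite mulf_eq0 !subr_eq0 (negPf vu) orbF.
by subst x2; move/addrI: e1 => ->.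
Qed.

(** If neither of the two removed parts holds an eighth of the points of a line,
three quarters of the points are kept, and (4/3)^3 < 3.  Lines with fewer than
16 points are absorbed by the pair count. *)
Lemma line_weight_split r r0 r1 r2 : (r <= r0 + r1 + r2)%N ->
  (line_weight r <= 3 * line_weight r0 + 512 * line_weight r1 + 512 * line_weight r2 + 32 * (r * r.-1))%N.
Proof.
move=> le_r; rewrite /line_weight; case: (leqP 2 r) => [r2'|_]; last by rewrite mul0n.
rewrite mul1n.
have [lt16|ge16] := ltnP r 16.
  apply: leq_trans (leq_addl _ _); rewrite expnS -mulnn.
  case: r {le_r} r2' lt16 => // r r2' lt16 /=; rewrite (mulnCA 32) leq_mul2l /=.
  by apply: (@leq_trans (16 * r.+1)); [rewrite leq_mul2r ltnW ?orbT|lia].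
have H (c m d n : nat) : (c * r <= d * m)%N -> (1 < m)%N -> (0 < c)%N -> (d ^ 3 <= n * c ^ 3)%N ->
   (r ^ 3 <= n * ((1 < m) * m ^ 3))%N.
  move=> le1 -> c0 led; rewrite mul1n.
  have : ((c * r) ^ 3 <= (d * m) ^ 3)%N by rewrite leq_exp2r.
  rewrite !expnMn => le3.
  rewrite -(leq_pmul2l (_ : 0 < c ^ 3)%N) ?expn_gt0 ?c0 //; apply: leq_trans le3 _.
  by rewrite mulnA leq_mul2r (mulnC (c ^ 3)%N) led orbT.
have H1 : (r <= 8 * r1 -> r ^ 3 <= 512 * ((1 < r1) * r1 ^ 3))%N.
  by move=> h; apply: (H 1 r1 8 512) => //; [rewrite mul1n|lia].
have H2 : (r <= 8 * r2 -> r ^ 3 <= 512 * ((1 < r2) * r2 ^ 3))%N.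
  by move=> h; apply: (H 1 r2 8 512) => //; [rewrite mul1n|lia].
have H0 : (3 * r <= 4 * r0 -> r ^ 3 <= 3 * ((1 < r0) * r0 ^ 3))%N.
  by move=> h; apply: (H 3 r0 4 3) => //; lia.
move: H0 H1 H2.
move: (r ^ 3)%N ((1 < r0) * r0 ^ 3)%N ((1 < r1) * r1 ^ 3)%N ((1 < r2) * r2 ^ 3)%N => c c0 c1 c2.
move: (r * r.-1)%N => c3 *.
case: (leqP r (8 * r1)) => h1; first by lia.
case: (leqP r (8 * r2)) => h2; first by lia.
lia.
Qed.

End Lines.

(** * An extremal grid *)

Section Extremal.
Variable F : finFieldType.
Implicit Types (A B C W X Y Z S U : {set F}) (c d t : F) (l : F * F).

Lemma line_count_split X Y X' Y' l : X' \subset X -> Y' \subset Y ->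
  (line_count X Y l <= line_count X' Y' l + line_count (X :\: X') Y l + line_count X (Y :\: Y') l)%N.
Proof.
move=> sX sY; rewrite /line_count.
apply: leq_trans (leq_trans (leq_card_setU _ _) (leq_add (leq_card_setU _ _) (leqnn _))).
apply/subset_leq_card/subsetP=> u; rewrite !inE => /andP[uX uY].
by rewrite uX uY; case: (u \in X'); case: (_ \in Y').
Qed.

Lemma collinear_triples0l Y : collinear_triples set0 Y = 0%N.
Proof.
rewrite /collinear_triples big1 // => l _; rewrite /line_weight /line_count.
suff -> : on_line l set0 Y = set0 by rewrite cards0.
by apply/setP=> u; rewrite !inE.
Qed.

Lemma collinear_triples0r X : collinear_triples X set0 = 0%N.
Proof.
rewrite /collinear_triples big1 // => l _; rewrite /line_weight /line_count.
suff -> : on_line l X set0 = set0 by rewrite cards0.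
by apply/setP=> u; rewrite !inE andbF.
Qed.

Lemma extremal_pair A : A != set0 -> exists X Y,
  [/\ X \subset A, Y \subset A, (0 < #|X|)%N, (0 < #|Y|)%N
   & forall X' Y', X' \subset A -> Y' \subset A ->
   (collinear_triples X' Y' ^ 2 * (#|X| * #|Y|) ^ 3 <= collinear_triples X Y ^ 2 * (#|X'| * #|Y'|) ^ 3)%N].
Proof.
move=> A0.
pose f (w : {set F} * {set F}) : rat := (collinear_triples w.1 w.2 ^ 2)%:R / ((#|w.1| * #|w.2|) ^ 3)%:R.
pose P (w : {set F} * {set F}) := [&& w.1 \subset A, w.2 \subset A, w.1 != set0 & w.2 != set0].
have PA : P (A, A) by rewrite /P /= subxx A0.
case: (@Order.TotalTheory.arg_maxP _ _ _ (A, A) P f PA) => -[X Y].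
move=> /and4P[/= sX sY X0 Y0] maxXY; exists X, Y; split; rewrite ?card_gt0 //.
move=> X' Y' sX' sY'.
have [->|X'0] := eqVneq X' set0; first by rewrite collinear_triples0l.
have [->|Y'0] := eqVneq Y' set0; first by rewrite collinear_triples0r.
have := maxXY (X', Y'); rewrite /P /= sX' sY' X'0 Y'0 => /(_ isT).
have gt0 (U V : {set F}) : U != set0 -> V != set0 -> 0 < ((#|U| * #|V|) ^ 3)%:R :> rat.
  by move=> U0 V0; rewrite ltr0n expn_gt0 muln_gt0 !card_gt0 U0 V0.
rewrite /f /= ler_pdivrMr ?gt0 // mulrAC ler_pdivlMr ?gt0 //.
by rewrite -!natrM ler_nat.
Qed.

(** The bound K s^3 / |X|^2 for a fourfold sum, one power of s / |X| better than
what the size of X + eps X gives in general. *)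
Definition small_quadrupling eps X (s K : nat) :=
  (#|addset (addset (addset X (dil eps X)) (dil eps X)) (dil eps X)| * #|X| ^ 2 <= K * s ^ 3)%N.

Lemma special_part eps A X s k : (0 < k)%N -> X \subset A -> (0 < #|X|)%N ->
  (#|addset A (dil eps A)| <= s)%N ->
  exists X', [/\ X' \subset X, (k * #|X :\: X'| <= #|X|)%N & small_quadrupling eps X' s (k ^ 3)].
Proof.
move=> k0 sX X0 les.
have leX : (#|addset X (dil eps X)| <= s)%N.
  by apply: leq_trans les; apply/subset_leq_card/addsetS => //; apply: dilS.
have [X' [sX' smallX' boundX']] := special_subset k0 leX.
exists X'; split=> //; rewrite /small_quadrupling.
have sE : dil eps X' \subset dil eps X by apply: dilS.
apply: (@leq_trans (#|addset (addset (addset X' (dil eps X)) (dil eps X)) (dil eps X)| * #|X| ^ 2)).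
  apply: leq_mul; last by rewrite leq_exp2r // subset_leq_card.
  by apply/subset_leq_card; do !apply: addsetS.
rewrite -(leq_pmul2r X0) -mulnA -expnSr; apply: leq_trans boundX' _.
by rewrite expnMn leq_mul2l subset_leq_card ?orbT.
Qed.

(** In a grid X x Y maximising T(X, Y)^2 / (|X| |Y|)^3, a strip of relative width
2^-8 carries at most a proportion (2^-8)^(3/2) = 2^-12 of the triples, so the
strips outside the special parts of X and Y may be dropped. *)
Lemma special_pair eps A s : A != set0 -> (#|addset A (dil eps A)| <= s)%N ->
  (collinear_triples A A <= 128 * #|A| ^ 4)%N \/
  exists X Y, [/\ X \subset A /\ Y \subset A, (0 < #|X|)%N /\ (0 < #|Y|)%N,
      small_quadrupling eps X s ((2 ^ 8) ^ 3)%N, small_quadrupling eps Y s ((2 ^ 8) ^ 3)%N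
    & (collinear_triples A A ^ 2 * (#|X| * #|Y|) ^ 3 <= 36 * collinear_triples X Y ^ 2 * #|A| ^ 6)%N].
Proof.
move=> A0 les.
have [X [Y [sX sY X0 Y0 maxXY]]] := extremal_pair A0.
have maxA := maxXY A A (subxx _) (subxx _).
set k := (2 ^ 8)%N; have k0 : (0 < k)%N by rewrite expn_gt0.
have [X' [sX' smallX qX]] := special_part k0 sX X0 les.
have [Y' [sY' smallY qY]] := special_part k0 sY Y0 les.
set T := collinear_triples X Y in maxXY maxA.
have small (t u v : nat) : (t ^ 2 * u ^ 3 <= T ^ 2 * v ^ 3)%N -> (k * v <= u)%N -> (0 < u)%N ->
    (2 ^ 12 * t <= T)%N.
  (* maximality gives t^2 / v^3 <= T^2 / u^3, and v is at most u / 2^8 *)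
  move=> le1 le2 u0; rewrite -(leq_exp2r _ _ (e := 2)) // expnMn.
  have -> : ((2 ^ 12) ^ 2 = k ^ 3)%N by rewrite -!expnM.
  rewrite -(leq_pmul2r (_ : 0 < u ^ 3)%N) ?expn_gt0 ?u0 // -mulnA.
  apply: (@leq_trans (k ^ 3 * (T ^ 2 * v ^ 3))); first by rewrite leq_mul2l le1 orbT.
  by rewrite mulnCA -expnMn leq_mul2l leq_exp2r // le2 orbT.
have sXA : X :\: X' \subset A by apply: subset_trans sX; apply: subsetDl.
have sYA : Y :\: Y' \subset A by apply: subset_trans sY; apply: subsetDl.
have small1 : (2 ^ 12 * collinear_triples (X :\: X') Y <= T)%N.
  apply: (small _ _ _ (maxXY _ _ sXA sY)); last by rewrite muln_gt0 X0.
  by rewrite mulnA leq_mul2r smallX orbT.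
have small2 : (2 ^ 12 * collinear_triples X (Y :\: Y') <= T)%N.
  apply: (small _ _ _ (maxXY _ _ sX sYA)); last by rewrite muln_gt0 X0.
  by rewrite mulnCA leq_mul2l smallY orbT.
pose P := (\sum_(l : F * F | l.1 != 0%R) line_count X Y l * (line_count X Y l).-1)%N.
have leP : (P <= (#|X| * #|Y|) ^ 2)%N by apply: sum_line_pairs.
have split : (T <= 3 * collinear_triples X' Y' + 512 * collinear_triples (X :\: X') Y
                 + 512 * collinear_triples X (Y :\: Y') + 32 * P)%N.
  rewrite /T /collinear_triples /P !big_distrr -!big_split /=.
  by apply: leq_sum => l _; apply: line_weight_split; apply: line_count_split.
have leXA := subset_leq_card sX; have leYA := subset_leq_card sY.
have [leT|ltT] := leqP T (128 * (#|X| * #|Y|) ^ 2).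
  left; rewrite -(leq_exp2r _ _ (e := 2)) //.
  have u0 : (0 < (#|X| * #|Y|) ^ 3)%N by rewrite expn_gt0 muln_gt0 X0 Y0.
  rewrite -(leq_pmul2r u0); apply: leq_trans maxA _.
  apply: (@leq_trans ((128 * (#|X| * #|Y|) ^ 2) ^ 2 * (#|A| * #|A|) ^ 3)).
    by rewrite leq_mul2r leq_exp2r // leT orbT.
  have -> : (#|A| ^ 4 = (#|A| * #|A|) ^ 2)%N by rewrite mulnn -expnM.
  have : (#|X| * #|Y| <= #|A| * #|A|)%N by apply: leq_mul.
  move: (128)%N (#|X| * #|Y|)%N (#|A| * #|A|)%N => m w v lewv.
  have -> : ((m * w ^ 2) ^ 2 * v ^ 3 = (m ^ 2 * w ^ 3 * v ^ 3) * w)%N by ring.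
  have -> : ((m * v ^ 2) ^ 2 * w ^ 3 = (m ^ 2 * w ^ 3 * v ^ 3) * v)%N by ring.
  by rewrite leq_mul2l lewv orbT.
have leT : (T <= 6 * collinear_triples X' Y')%N.
  have e12 : (2 ^ 12 = 8 * 512)%N by rewrite (expnD 2 3 9).
  rewrite e12 in small1 small2; lia.
have T_gt0 : (0 < 6 * collinear_triples X' Y')%N by apply: leq_trans leT; apply: leq_ltn_trans ltT.
right; exists X', Y'; split=> //.
- by split; [apply: subset_trans sX | apply: subset_trans sY].
- rewrite !card_gt0; split; apply: contraTneq T_gt0 => ->.
    by rewrite collinear_triples0l.
  by rewrite collinear_triples0r.
apply: (@leq_trans (collinear_triples A A ^ 2 * (#|X| * #|Y|) ^ 3)).
  by rewrite leq_mul2l leq_exp2r // leq_mul ?orbT // subset_leq_card.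
apply: leq_trans maxA _.
have -> : ((#|A| * #|A|) ^ 3 = #|A| ^ 6)%N by rewrite mulnn -expnM.
rewrite leq_mul2r; apply/orP; right.
have : (T ^ 2 <= (6 * collinear_triples X' Y') ^ 2)%N by rewrite leq_exp2r.
by rewrite expnMn.
Qed.
End Extremal.

(** * Rich lines through one point *)

Lemma exists_above_average (I : finType) (P : {pred I}) (f : I -> nat) : (0 < #|P|)%N ->
  exists2 i, i \in P & (\sum_(i in P) f i <= #|P| * f i)%N.
Proof.
case/card_gt0P=> i0 Pi0; exists [arg max_(i > i0 in P) f i].
  by case: arg_maxnP.
case: arg_maxnP => // i Pi maxi; rewrite -sum_nat_const; exact: leq_sum.
Qed.

Lemma card_pairs (I J : finType) (P : pred I) (Q : I -> {set J}) :
  #|[set z : I * J | P z.1 && (z.2 \in Q z.1)]| = (\sum_(i | P i) #|Q i|)%N.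
Proof.
under eq_bigr => i _ do rewrite -sum1_card.
rewrite pair_big_dep -sum1_card; apply: eq_bigl => -[i j].
by rewrite inE.
Qed.

Section Reduction.
Variable F : finFieldType.
Implicit Types (A B C W X Y Z S U D : {set F}) (c d t xi : F) (l : F * F).

(** A sextuple with a_1 <> a_2 and b_1 <> b_2 is a triple on a line of finite
nonzero slope.  In the others two of the differences vanish, which leaves
three families with four free parameters. *)
Lemma sextuples_le A :
  (collinear_sextuples A <= collinear_triples A A + 3 * #|A| ^ 4)%N.
Proof.
pose Q l := let R := on_line l A A in setX (setX R R) R.
pose P l := (l.1 != 0) && (1 < line_count A A l)%N.
pose S3 := [set z | P z.1 && (z.2 \in Q z.1)].
have -> : collinear_triples A A = #|S3|.
  rewrite card_pairs /P big_mkcondr; apply: eq_bigr => l _.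
  rewrite /line_weight !cardsX -/(line_count A A l).
  by case: leqP => // _; rewrite mul1n !expnS muln1 mulnA.
pose A4 := setX (setX (setX A A) A) A.
have A4E : #|A4| = (#|A| ^ 4)%N by rewrite !cardsX !expnS muln1 !mulnA.
pose fl (z : (F * F) * (F * F * F)) : (F * F * F) * (F * F * F) :=
  let f u := z.1.1 * u + z.1.2 in (z.2, (f z.2.1.1, f z.2.1.2, f z.2.2)).
pose g1 (w : F * F * F * F) : (F * F * F) * (F * F * F) :=
  let: (a, b, c, d) := w in ((a, a, a), (b, c, d)).
pose g2 (w : F * F * F * F) : (F * F * F) * (F * F * F) :=
  let: (a, b, c, d) := w in ((a, a, b), (c, c, d)).
pose g3 (w : F * F * F * F) : (F * F * F) * (F * F * F) :=
  let: (a, b, c, d) := w in ((b, c, d), (a, a, a)).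
have le4 (g : F * F * F * F -> (F * F * F) * (F * F * F)) : (#|g @: A4| <= #|A| ^ 4)%N.
  by rewrite -A4E leq_imset_card.
apply: (@leq_trans #|fl @: S3 :|: (g1 @: A4 :|: (g2 @: A4 :|: g3 @: A4))|); last first.
  apply: leq_trans (leq_card_setU _ _) _; apply: leq_add; first exact: leq_imset_card.
  apply: leq_trans (leq_card_setU _ _) _; rewrite mulSn; apply: leq_add => //.
  apply: leq_trans (leq_card_setU _ _) _; rewrite mulSn mul1n; exact: leq_add.
apply/subset_leq_card/subsetP => -[[[a1 a2] a3] [[b1 b2] b3]].
rewrite inE => /and3P[a1A a2A /and5P[a3A b1A b2A b3A /eqP col]].
rewrite !in_setU.
have [a21|a21] := eqVneq a2 a1.
  have [a31|a31] := eqVneq a3 a1.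
    apply/orP; right; apply/orP; left; apply/imsetP.
    by exists (a1, b1, b2, b3); rewrite ?a21 ?a31 // !in_setX /= a1A b1A b2A b3A.
  have b21 : b2 = b1.
    apply/eqP; move/eqP: col; rewrite a21 subrr mul0r eq_sym mulf_eq0 !subr_eq0.
    by rewrite (negPf a31).
  do 2!(apply/orP; right); apply/orP; left; apply/imsetP.
  by exists (a1, a3, b1, b3); rewrite ?a21 ?b21 // !in_setX /= a1A a3A b1A b3A.
have [b21|b21] := eqVneq b2 b1.
  have b31 : b3 = b1.
    apply/eqP; move/eqP: col; rewrite b21 subrr mulr0 mulf_eq0 !subr_eq0.
    by rewrite (negPf a21).
  do 3!(apply/orP; right); apply/imsetP.
  by exists (b1, a1, a2, a3); rewrite ?b21 ?b31 // !in_setX /= a1A a2A a3A b1A.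
apply/orP; left; apply/imsetP.
have a0 : a2 - a1 != 0 by rewrite subr_eq0.
pose xi := (b2 - b1) / (a2 - a1); pose t := b1 - xi * a1.
have e1 : xi * a1 + t = b1 by rewrite addrC subrK.
have e2 : xi * a2 + t = b2 by rewrite /t /xi; field.
have e3 : xi * a3 + t = b3.
  have -> : xi * a3 + t = b1 + (a3 - a1) * (b2 - b1) / (a2 - a1) by rewrite /t /xi; field.
  by rewrite -col mulrAC mulfV // mul1r addrC subrK.
exists ((xi, t), (a1, a2, a3)); last by rewrite /fl /= e1 e2 e3.
have on1 : a1 \in on_line (xi, t) A A by rewrite inE a1A /= e1.
have on2 : a2 \in on_line (xi, t) A A by rewrite inE a2A /= e2.
have on3 : a3 \in on_line (xi, t) A A by rewrite inE a3A /= e3.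
rewrite inE /P !in_setX on1 on2 on3 /= !andbT mulf_neq0 ?invr_eq0 ?subr_eq0 //=.
rewrite /line_count (cardD1 a1) on1 (cardD1 a2) inE /= on2 /= andbT.
by rewrite (negPf a21).
Qed.

(** The sizes N are powers of two up to a, and one of them carries at least the
average share of the triples. *)
Lemma dyadic X Y a : (#|X| <= a)%N -> (1 < a)%N -> exists2 N, (1 < N)%N &
  (collinear_triples X Y <= trunc_log 2 a *
     \sum_(l : F * F | (l.1 != 0%R) && (N <= line_count X Y l < 2 * N)%N) line_count X Y l ^ 3)%N.
Proof.
move=> leX a1; set L := trunc_log 2 a.
have L0 : (0 < L)%N by rewrite /L trunc_log_gt0.
pose Ts i := (\sum_(l : F * F | (l.1 != 0%R) && (2 ^ i.+1 <= line_count X Y l < 2 * 2 ^ i.+1)%N) line_count X Y l ^ 3)%N.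
have [|i _ lei] := @exists_above_average 'I_L predT (fun i => Ts (val i)); first by rewrite card_ord.
exists (2 ^ i.+1)%N; first by rewrite -(expn0 2) ltn_exp2l.
rewrite card_ord in lei; apply: leq_trans lei.
rewrite /collinear_triples /Ts.
under [X in (_ <= X)%N]eq_bigr => j _ do rewrite big_mkcondr.
rewrite exchange_big /=; apply: leq_sum => l _.
rewrite /line_weight; case: ltnP => [r1|_]; last by rewrite mul0n.
set r := line_count X Y l in r1 *.
have ra : (r <= a)%N by apply: leq_trans leX; apply: line_count_le.
have t0 : (0 < trunc_log 2 r)%N by rewrite trunc_log_gt0.
have tL : ((trunc_log 2 r).-1 < L)%N by rewrite prednK // leq_trunc_log.
rewrite mul1n (bigD1 (Ordinal tL)) //= prednK //.
have r0 : (0 < r)%N by apply: ltnW.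
have /andP[-> h] := trunc_log_bounds (isT : (1 < 2)%N) r0.
by rewrite -expnS h leq_addr.
Qed.

(** Part of the line of slope xi through the origin, as a set of abscissas; the
origin, which is on all these lines, is left out. *)
Definition fiber X Y xi : {set F} := [set u in X | (u != 0) && (xi * u \in Y)].
Definition translate t X : {set F} := addset X [set - t].

Lemma mem_translate t X u : (u \in translate t X) = (u + t \in X).
Proof.
apply/imset2P/idP => [[a b aX /set1P-> ->]|uX]; first by rewrite subrK.
by exists (u + t) (- t); rewrite ?set11 ?addrK.
Qed.

Lemma card_fiber X Y x1 y1 xi : x1 \in X -> y1 \in Y ->
  line_count X Y (xi, y1 - xi * x1) = #|fiber (translate x1 X) (translate y1 Y) xi|.+1.
Proof.
move=> x1X y1Y; rewrite /line_count (cardsD1 x1) inE x1X /= addrC subrK y1Y add1n; congr _.+1.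
rewrite -(card_imset _ (@subIr _ x1)); apply: eq_card => u.
rewrite inE mem_translate mem_translate; apply/imsetP/and3P.
  move=> [v]; rewrite !inE /= => /and3P[vx vX vY] ->; rewrite subrK vX subr_eq0 vx; split=> //.
  by rewrite mulrBr -addrA (addrC (- _)).
move=> [uX u0 uY]; exists (u + x1); last by rewrite addrK.
rewrite !inE /= uX -subr_eq0 addrK u0 /=.
by rewrite (_ : xi * (u + x1) + (y1 - xi * x1) = xi * u + y1) //; ring.
Qed.

(** Summing over the first point of the triple, some point carries at least the
average.  Translating it to the origin makes the lines through it into
dilations. *)
Lemma base_point X Y N : (0 < #|X|)%N -> (0 < #|Y|)%N -> (1 < N)%N ->
  exists x1 y1 D, [/\ x1 \in X, y1 \in Y, 0 \notin D,
    forall xi, xi \in D -> (N <= 2 * #|fiber (translate x1 X) (translate y1 Y) xi| <= 4 * N)%N &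
    (\sum_(l : F * F | (l.1 != 0%R) && (N <= line_count X Y l < 2 * N)%N) line_count X Y l ^ 3
     <= 4 * N * #|X| * #|Y| * \sum_(xi in D) #|fiber (translate x1 X) (translate y1 Y) xi|)%N].
Proof.
move=> X0 Y0 N1.
pose L l := (l.1 != 0) && (N <= line_count X Y l < 2 * N)%N.
pose thru l (w : F * F) := l.1 * w.1 + l.2 == w.2.
have E : (\sum_(l | L l) line_count X Y l ^ 3 =
   \sum_(w in setX X Y) \sum_(l | L l && thru l w) line_count X Y l ^ 2)%N.
  rewrite (exchange_big_dep L) /=; last by move=> w l _ /andP[].
  apply: eq_bigr => l Ll; rewrite Ll.
  rewrite sum_nat_const expnS; congr (_ * _)%N.
  rewrite /line_count -(@card_in_imset _ _ (fun u => (u, l.1 * u + l.2))); last first.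
    by move=> u v _ _ [].
  apply: eq_card => -[u v]; apply/imsetP/idP.
    move=> [u']; rewrite inE => /andP[uX vY] [-> ->].
    by rewrite unfold_in /= in_setX /= uX vY /thru /= eqxx.
  rewrite unfold_in /= in_setX /thru /= => /andP[/andP[uX vY] /eqP uv].
  by exists u; rewrite ?inE ?uX uv.
have [|[x1 y1] /setXP[/= x1X y1Y] le1] := @exists_above_average _ (setX X Y)
    (fun w => \sum_(l | L l && thru l w) line_count X Y l ^ 2)%N.
  by rewrite cardsX muln_gt0 X0.
pose g xi := (xi, y1 - xi * x1).
exists x1, y1, [set xi | L (g xi)]; split=> //.
- by rewrite inE /L /g /= eqxx.
- move=> xi; rewrite inE /L /g /= => /and3P[_].
  by rewrite card_fiber //; move: #|_| => m; lia.
rewrite E; apply: leq_trans le1 _; rewrite cardsX.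
rewrite (_ : (4 * N * #|X| * #|Y| = #|X| * #|Y| * (4 * N))%N); last by lia.
rewrite -(mulnA (#|X| * #|Y|)%N) leq_mul2l; apply/orP; right.
rewrite (reindex_onto g fst) /=; last first.
  move=> [xi t] /andP[_]; rewrite /thru /g /= => /eqP <-.
  by rewrite addrC addKr.
rewrite big_distrr /= (eq_bigl (fun xi => xi \in [set xi | L (g xi)])); last first.
  by move=> xi; rewrite inE /thru /g /= (addrC (xi * x1)) subrK !eqxx !andbT.
apply: leq_sum => xi; rewrite inE /L /g /= => /and3P[_].
by rewrite card_fiber //; move: #|_| => m; rewrite -mulnn; nia.
Qed.

End Reduction.

(** * Collisions, stabilisers and quotients of differences *)

(** Cauchy-Schwarz for the fibres of f. *)
Lemma collision_bound (I J : finType) (P : {set I}) (f : I -> J) :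
  (#|P| ^ 2 <= #|f @: P| * \sum_(p in P) \sum_(q in P) (f p == f q))%N.
Proof.
pose n z := (\sum_(p in P) (f p == z))%N.
have sumn : (\sum_(z in f @: P) n z = #|P|)%N.
  rewrite /n exchange_big /= -sum1_card; apply: eq_bigr => p pP.
  rewrite (bigD1 (f p)) ?imset_f //= eqxx big1 ?addn0 // => z /andP[_ zp].
  by rewrite eq_sym (negPf zp).
have sumE : (\sum_(p in P) \sum_(q in P) (f p == f q) = \sum_(z in f @: P) n z ^ 2)%N.
  rewrite (partition_big_imset f) /=; apply: eq_bigr => z _.
  rewrite -mulnn {1}/n big_distrl /= big_mkcondr; apply: eq_bigr => p _.
  case: eqP => [fp|_]; last by rewrite mul0n.
  by rewrite mul1n /n; apply: eq_bigr => q _; rewrite fp eq_sym.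
rewrite sumE -sumn -mulnn.
rewrite -(leq_pmul2l (isT : (0 < 2)%N)).
apply: (@leq_trans (\sum_(z in f @: P) \sum_(w in f @: P) (n z ^ 2 + n w ^ 2))%N).
  rewrite big_distrl big_distrr /=; apply: leq_sum => z _.
  by rewrite !big_distrr /=; apply: leq_sum => w _; apply: nat_Cauchy.
under eq_bigr => z _ do rewrite big_split /= sum_nat_const.
by rewrite big_split /= sum_nat_const -big_distrr /= mul2n addnn.
Qed.

Section Algebra.
Variable F : finFieldType.
Implicit Types (A B C W X Y Z S U V D G R : {set F}) (c d t xi z l : F).

(** Two distinct points of V x V collide under (u, v) |-> u + r v for at most one
r, so on average over r in G there are at most |V|^2 + |V|^4 / |G| collisions,
the diagonal included. *)
Lemma few_collisions G V : (0 < #|G|)%N -> exists2 r, r \in G &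
  (#|V| ^ 2 * #|G| <= #|addset V (dil r V)| * (#|G| + #|V| ^ 2))%N.
Proof.
move=> G0; pose P := setX V V; pose f r (p : F * F) := p.1 + r * p.2.
pose E r := (\sum_(p in P) \sum_(q in P) (f r p == f r q))%N.
have cardP : #|P| = (#|V| ^ 2)%N by rewrite cardsX mulnn.
have sumE : (\sum_(r in G) E r <= #|V| ^ 2 * (#|G| + #|V| ^ 2))%N.
  rewrite /E exchange_big /= -cardP -sum_nat_const; apply: leq_sum => p pP.
  rewrite exchange_big /= (bigD1 p) //=; apply: leq_add.
    by rewrite -sum1_card; apply: leq_sum => r _; rewrite leq_b1.
  rewrite -sum1_card [X in (_ <= X)%N](bigID (fun q => q != p)) /=; apply: leq_trans (leq_addr _ _).
  apply: leq_sum => q /andP[_ qp].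
  rewrite -big_mkcondr sum1_card.
  apply: (@leq_trans #|[set (q.1 - p.1) / (p.2 - q.2)]|); last by rewrite cards1.
  apply/subset_leq_card/subsetP=> r; rewrite !inE => /andP[_ /eqP fr].
  have er : r * (p.2 - q.2) = q.1 - p.1.
    have -> : r * (p.2 - q.2) = f r p - f r q + (q.1 - p.1) by rewrite /f; ring.
    by rewrite fr subrr add0r.
  have [e2|ne2] := eqVneq p.2 q.2.
    case/negP: qp; apply/eqP; move: er; rewrite e2 subrr mulr0 => /esym/eqP; rewrite subr_eq0 => /eqP e1.
    by rewrite (surjective_pairing p) (surjective_pairing q) e1 e2.
  by rewrite -er mulfK // subr_eq0.
have [r rG minr] : exists2 r, r \in G & (#|G| * E r <= \sum_(r in G) E r)%N.
  case/card_gt0P: G0 => r0 r0G; exists [arg min_(r < r0 in G) E r]; first by case: arg_minnP.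
  by case: arg_minnP => // r rG minr; rewrite -sum_nat_const; apply: leq_sum.
exists r => //.
have fE : f r @: P \subset addset V (dil r V).
  by apply/subsetP=> _ /imsetP[[p1 p2] /setXP[/= p1V p2V] ->]; rewrite mem_addset ?mem_dil.
have coll : (#|V| ^ 2 * #|V| ^ 2 <= #|addset V (dil r V)| * E r)%N.
  rewrite mulnn -cardP; apply: leq_trans (collision_bound P (f r)) _.
  by rewrite leq_mul2r subset_leq_card ?orbT.
have [->|V0] := posnP (#|V| ^ 2)%N; first by rewrite mul0n.
rewrite -(leq_pmul2l V0) mulnA.
apply: (@leq_trans (#|addset V (dil r V)| * E r * #|G|)); first by rewrite leq_mul2r coll orbT.
rewrite -mulnA (mulnC (E r)) [X in (_ <= X)%N]mulnCA leq_mul2l; apply/orP; right.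
by apply: leq_trans minr sumE.
Qed.

Lemma finite_surj R (f : F -> F) : injective f -> (forall z, z \in R -> f z \in R) ->
  forall z, z \in R -> exists2 w, w \in R & f w = z.
Proof.
move=> injf fR z zR; have : f @: R = R.
  apply/eqP; rewrite eqEcard card_imset // leqnn andbT.
  by apply/subsetP=> _ /imsetP[w wR ->]; apply: fR.
by move=> fRE; move: zR; rewrite -{1}fRE => /imsetP[w wR ->]; exists w.
Qed.

(** Let S be the additive group of translations preserving R, and G the ring of
multipliers preserving S.  Injective self-maps of finite sets are onto, so G is
a field.  Multipliers preserving R preserve S; and since 1 lies in S and 0 in
R, each g in G equals 0 + g * 1 and hence lies in R. *)
Lemma stabilizer_field R (L : {set F}) eps : eps ^+ 2 = 1 -> 0 \in R ->
  (forall z, z \in R -> z + eps \in R) ->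
  (forall c z, c \in L -> z \in R -> c * z \in R) -> 0 \notin L ->
  exists G, [/\ GRing.divring_closed G, G \subset R & L \subset G].
Proof.
move=> e2 R0 Reps RL L0.
pose S := [set l | [forall (z | z \in R), z + l \in R]].
have SP l : reflect (forall z, z \in R -> z + l \in R) (l \in S).
  by rewrite inE; apply: forall_inP.
have SN l : l \in S -> - l \in S.
  move=> /SP Sl; apply/SP=> z zR.
  by have [w wR <-] := finite_surj (@addIr _ l) Sl zR; rewrite addrK.
have SD l l' : l \in S -> l' \in S -> l + l' \in S.
  by move=> /SP Sl /SP Sl'; apply/SP=> z zR; rewrite addrA Sl' ?Sl.
have S0 : 0 \in S by apply/SP=> z zR; rewrite addr0.
have S1 : 1 \in S.
  have Se : eps \in S by apply/SP.
  by move/eqP: e2; rewrite sqrf_eq1 => /orP[] /eqP eE; rewrite -?eE // -[1]opprK -eE SN.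
pose G := [set g | [forall (l | l \in S), g * l \in S]].
have GP g : reflect (forall l, l \in S -> g * l \in S) (g \in G).
  by rewrite inE; apply: forall_inP.
exists G; split.
- split.
  + by apply/GP=> l Sl; rewrite mul1r.
  + by move=> x y /GP Gx /GP Gy; apply/GP=> l Sl; rewrite mulrBl SD ?SN ?Gx ?Gy.
  + move=> x y /GP Gx /GP Gy; apply/GP=> l Sl.
    have [->|y0] := eqVneq y 0; first by rewrite invr0 mulr0 mul0r.
    have [w Sw <-] := finite_surj (mulfI y0) Gy Sl.
    by rewrite mulrA mulfVK // Gx.
- by apply/subsetP=> g /GP/(_ _ S1); rewrite mulr1 => /SP/(_ _ R0); rewrite add0r.
- apply/subsetP=> l lL; apply/GP=> m /SP Sm; apply/SP=> z zR.
  have l0 : l != 0 by apply: contraNneq L0 => <-.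
  have [w wR <-] := finite_surj (mulfI l0) (fun z => RL l z lL) zR.
  by rewrite -mulrDr RL ?Sm.
Qed.

Definition diff_ratios B B' : {set F} := [set z | [exists w : (F * F) * (F * F),
  [&& w.1.1 \in B, w.1.2 \in B, w.2.1 \in B', w.2.2 \in B' &
      (w.2.1 != w.2.2) && (z * (w.2.1 - w.2.2) == w.1.1 - w.1.2)]]].

Lemma diff_ratiosP B B' z : reflect
  (exists a b c d, [/\ (a \in B) /\ (b \in B), (c \in B') /\ (d \in B'), c != d
     & z * (c - d) = a - b]) (z \in diff_ratios B B').
Proof.
rewrite inE; apply: (iffP existsP).
  by case=> -[[a b] [c d]] /= /and5P[? ? ? ? /andP[? /eqP ?]]; exists a, b, c, d.
move=> [a [b [c [d [[aB bB] [cB dB] cd e]]]]]; exists ((a, b), (c, d)) => /=.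
by rewrite aB bB cB dB cd e eqxx.
Qed.

Lemma diff_ratiosS B1 B1' B2 B2' : B1 \subset B2 -> B1' \subset B2' -> diff_ratios B1 B1' \subset diff_ratios B2 B2'.
Proof.
move=> /subsetP sB /subsetP sB'; apply/subsetP=> z /diff_ratiosP[a [b [c [d [[? ?] [? ?] ? ?]]]]].
by apply/diff_ratiosP; exists a, b, c, d; rewrite !sB ?sB'.
Qed.

(** A coincidence a + z b = a' + z b' with b <> b' exhibits z as a quotient of
differences. *)
Lemma card_unique_sums B B' z : z \notin diff_ratios B B' -> #|addset B (dil z B')| = (#|B| * #|B'|)%N.
Proof.
move=> zR; have -> : addset B (dil z B') = (fun w : F * F => w.1 + z * w.2) @: setX B B'.
  apply/setP=> y; apply/imset2P/imsetP.
    by move=> [a _ aB /imsetP[b bB ->] ->]; exists (a, b); rewrite // inE /= aB bB.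
  by move=> [[a b] /setXP[/= aB bB] ->]; exists a (z * b); rewrite ?mem_dil.
rewrite card_in_imset ?cardsX // => -[a b] [a' b'] /setXP[/= aB bB] /setXP[/= aB' bB'] e.
have [e2|ne] := eqVneq b b'; first by move: e; rewrite e2 => /addIr ->.
case/negP: zR; apply/diff_ratiosP; exists a', a, b, b'; split=> //.
have -> : z * (b - b') = (a + z * b) - (a' + z * b') + (a' - a) by ring.
by rewrite e subrr add0r.
Qed.

(** Differences of B and of B' may be measured in different units l and l'; the
quotient of the units appears as a multiplier. *)
Lemma diff_ratios_scale B B' S l l' z : l != 0 -> l' != 0 ->
  (forall b, b \in B -> b / l \in S) -> (forall b, b \in B' -> b / l' \in S) ->
  z \in diff_ratios B B' -> z * (l' / l) \in diff_ratios S S.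
Proof.
move=> l0 l'0 BS BS' /diff_ratiosP[a [b [c [d [[aB bB] [cB dB] cd e]]]]].
apply/diff_ratiosP; exists (a / l), (b / l), (c / l'), (d / l'); rewrite !BS // !BS' //.
split=> //; first by apply: contra cd => /eqP h; rewrite -(divfK l'0 c) h divfK.
rewrite -mulrBl -mulrBl -e; field; exact/andP.
Qed.
End Algebra.

(** * Quotients of differences of rich slopes are cheap *)

(** One step of a multiplicative estimate: exhibit the factor a on the left, and
continue with b in its place. *)
Lemma leq_mul_step (t a b u v : nat) : (a <= b)%N -> t = (u * a)%N -> (u * b <= v)%N -> (t <= v)%N.
Proof. by move=> leab ->; apply: leq_trans; rewrite leq_mul2l leab orbT. Qed.

Lemma four_covers_arith (P p0 p1 p2 p3 p4 wa wb wc wd y K s N : nat) :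
  (P <= p0 -> wc * p0 <= s * p1 -> wd * p1 <= s * p2 -> wa * p2 <= s * p3 ->
   wb * p3 <= s * p4 -> p4 * y <= K * s ^ 3 ->
   N <= 2 * wa -> N <= 2 * wb -> N <= 2 * wc -> N <= 2 * wd ->
   P * (N ^ 4 * y) <= 16 * K * s ^ 7)%N.
Proof.
move=> leP h1 h2 h3 h4 h5 na nb nc nd.
have nN : (N ^ 4 <= 2 * wa * (2 * wb) * (2 * wc) * (2 * wd))%N.
  have -> : (N ^ 4 = N * N * N * N)%N by ring.
  by rewrite !leq_mul.
apply: leq_trans (leq_mul leP (leq_mul nN (leqnn y))) _.
apply: (leq_mul_step (u := (16 * wa * wb * wd * y)%N) h1); first by ring.
apply: (leq_mul_step (u := (16 * wa * wb * y * s)%N) h2); first by ring.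
apply: (leq_mul_step (u := (16 * wb * y * s ^ 2)%N) h3); first by ring.
apply: (leq_mul_step (u := (16 * y * s ^ 3)%N) h4); first by ring.
apply: (leq_mul_step (u := (16 * s ^ 4)%N) h5); first by ring.
by apply: eq_leq; ring.
Qed.

Lemma three_covers_arith (x1 u1 u2 k p0 p1 p2 p3 wa wc wd y K s N : nat) : (0 < x1 ->
   x1 * u2 * x1 <= k * p0 -> k * u1 <= s * x1 ->
   wc * p0 <= k * p1 -> wd * p1 <= s * p2 -> wa * p2 <= s * p3 -> p3 * y <= K * s ^ 3 ->
   N <= 2 * wa -> N <= 2 * wc -> N <= 2 * wd ->
   u1 ^ 2 * u2 * N ^ 3 * y <= 8 * K * s ^ 7)%N.
Proof.
move=> x10 h0 hk h1 h2 h3 h4 na nc nd.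
have nN : (N ^ 3 <= 2 * wa * (2 * wc) * (2 * wd))%N.
  have -> : (N ^ 3 = N * N * N)%N by ring.
  by rewrite !leq_mul.
rewrite -(leq_pmul2l (_ : 0 < x1 ^ 2)%N) ?expn_gt0 ?x10 //.
apply: (leq_mul_step (u := (x1 ^ 2 * u1 ^ 2 * u2 * y)%N) nN); first by ring.
apply: (leq_mul_step (u := (8 * wa * wc * wd * u1 ^ 2 * y)%N) h0); first by ring.
apply: (leq_mul_step (u := (8 * wa * wd * u1 ^ 2 * y * k)%N) h1); first by ring.
apply: (leq_mul_step (u := (8 * wa * u1 ^ 2 * y * k ^ 2)%N) h2); first by ring.
apply: (leq_mul_step (u := (8 * u1 ^ 2 * y * k ^ 2 * s)%N) h3); first by ring.
apply: (leq_mul_step (u := (8 * u1 ^ 2 * k ^ 2 * s ^ 2)%N) h4); first by ring.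
apply: (leq_mul_step (u := (8 * u1 * k * K * s ^ 5)%N) hk); first by ring.
apply: (leq_mul_step (u := (8 * x1 * K * s ^ 6)%N) hk); first by ring.
by apply: eq_leq; ring.
Qed.

Section Bounds.
Variable F : finFieldType.
Implicit Types (A B C W X Y Z S U V D G R : {set F}) (c d t xi z l : F).

Variables (eps : F) (X Y D : {set F}) (s K N : nat).
Hypothesis e2 : eps ^+ 2 = 1.
Hypothesis leX : (#|addset X (dil eps X)| <= s)%N.
Hypothesis smallY : small_quadrupling eps Y s K.
Hypothesis richD : forall xi, xi \in D -> (N <= 2 * #|fiber X Y xi|)%N.

Lemma fiber_sub xi : fiber X Y xi \subset X.
Proof. by apply/subsetP=> u; rewrite inE => /andP[]. Qed.

Lemma dil_fiber xi : dil xi (fiber X Y xi) \subset Y.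
Proof. by apply/subsetP=> _ /imsetP[u + ->]; rewrite inE => /and3P[]. Qed.

Lemma cover_fiber tau xi xi' xi'' B Z m : tau ^+ 2 = 1 ->
  xi'' = tau * xi' -> (#|addset B (dil eps (fiber X Y xi))| <= m)%N ->
  (#|fiber X Y xi| * #|addset (dil xi' B) Z|
     <= m * #|addset (dil xi'' (fiber X Y xi)) Z|)%N.
Proof.
move=> t2 -> lem; have h := cover_dilate xi' B (fiber X Y xi) Z e2 t2; apply: leq_trans h _.
by rewrite leq_mul2r lem orbT.
Qed.

(** After multiplication by c - d the sum is part of c B - d B + a B' - b B'.
Each dilate is replaced by a piece of Y; the signs tau are chosen so that the
result lies in Y + eps Y + eps Y + eps Y. *)
Lemma card_ratio_sum_le B B' z : B \subset X -> B' \subset X -> z \in diff_ratios D D ->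
  (#|addset B (dil z B')| * (N ^ 4 * #|Y| ^ 2) <= 16 * K * s ^ 7)%N.
Proof.
move=> sB sB' /diff_ratiosP[a [b [c [d [[aD bD] [cD dD] cd ez]]]]].
have k0 : c - d != 0 by rewrite subr_eq0.
have le_s xi B0 : B0 \subset X -> (#|addset B0 (dil eps (fiber X Y xi))| <= s)%N.
  move=> sB0; apply: leq_trans leX; apply/subset_leq_card/addsetS => //.
  exact/dilS/fiber_sub.
have ne2 : (- eps) ^+ 2 = 1 by rewrite sqrrN.
have o2 : (1 : F) ^+ 2 = 1 by rewrite expr1n.
pose Wc := fiber X Y c; pose Wd := fiber X Y d; pose Wa := fiber X Y a; pose Wb := fiber X Y b.
pose Ba := dil a B'; pose Bb := dil (- b) B'; pose Bd := dil (- d) B.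
have p0 : (#|addset B (dil z B')| <= #|addset (dil c B) (addset Bd (addset Ba Bb))|)%N.
  rewrite -(card_dil _ k0) dil_add dil_dil (mulrC _ z) ez addsetA.
  by apply/subset_leq_card/addsetS; apply: dil_subset_add.
have swap (U V T : {set F}) : addset U (addset V T) = addset V (addset U T).
  by rewrite !addsetA (addsetC U).
pose Q1 := dil c Wc; pose Q2 := dil (eps * d) Wd; pose Q3 := dil (eps * a) Wa; pose Q4 := dil (eps * b) Wb.
have p1 : (#|Wc| * #|addset (dil c B) (addset Bd (addset Ba Bb))|
    <= s * #|addset Bd (addset Q1 (addset Ba Bb))|)%N.
  by rewrite (swap Bd Q1); apply: (cover_fiber (tau := 1)); rewrite ?mul1r // le_s.
have p2 : (#|Wd| * #|addset Bd (addset Q1 (addset Ba Bb))| <= s * #|addset Ba (addset Q2 (addset Q1 Bb))|)%N.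
  rewrite (swap Ba) (swap Ba Q1).
  by apply: (cover_fiber (tau := - eps)); rewrite ?mulrNN // le_s.
have p3 : (#|Wa| * #|addset Ba (addset Q2 (addset Q1 Bb))| <= s * #|addset Bb (addset Q3 (addset Q2 Q1))|)%N.
  rewrite (swap Bb Q3) (swap Bb Q2) (addsetC Bb).
  by apply: (cover_fiber (tau := eps)); rewrite // le_s.
have p4 : (#|Wb| * #|addset Bb (addset Q3 (addset Q2 Q1))| <= s * #|addset Q4 (addset Q3 (addset Q2 Q1))|)%N.
  by apply: (cover_fiber (tau := - eps)); rewrite ?mulrNN // le_s.
have sQ xi : dil (eps * xi) (fiber X Y xi) \subset dil eps Y.
  by rewrite -dil_dil; apply: dilS; apply: dil_fiber.
have p5 : (#|addset Q4 (addset Q3 (addset Q2 Q1))| <=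
   #|addset (addset (addset Y (dil eps Y)) (dil eps Y)) (dil eps Y)|)%N.
  rewrite addsetC (addsetC Q3) (addsetC Q2).
  apply/subset_leq_card; do 3!(apply: addsetS; last exact: sQ).
  exact: dil_fiber.
have {p5} p5 : (#|addset Q4 (addset Q3 (addset Q2 Q1))| * #|Y| ^ 2 <= K * s ^ 3)%N.
  by apply: leq_trans smallY; rewrite leq_mul2r p5 orbT.
move: p0 p1 p2 p3 p4 p5 (richD aD) (richD bD) (richD cD) (richD dD).
exact: four_covers_arith.
Qed.

(** Let X1 be a subset of U1 minimising the growth by eps X.  Then X1 + (z + eps) U2
lies in X1 + eps X + z U2, so Petridis's lemma removes the shift eps at the cost
of the ratio of X1.  That ratio also replaces s in the first of the three
covers, which makes the bound proportional to |X1| and lets X1 be of any size.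
The dilate by b is not covered: U2 lies on the line of slope b. *)
Lemma shifted_ratio_bound U1 U2 b z : U1 \subset X -> U1 != set0 -> U2 \subset fiber X Y b ->
  (exists a c d, [/\ a \in D, c \in D, d \in D, c != d & z * (c - d) = a - b]) ->
  z + eps \notin diff_ratios U1 U2 ->
  (#|U1| ^ 2 * #|U2| * N ^ 3 * #|Y| ^ 2 <= 8 * K * s ^ 7)%N.
Proof.
move=> sU1 U10 sU2 [a [c [d [aD cD dD cd ez]]]] zU.
have [X1 [sX1 X10 minX1 leX1]] := petridis_min_exists (dil eps X) U10.
have k0 : c - d != 0 by rewrite subr_eq0.
have sX1X : X1 \subset X := subset_trans sX1 sU1.
have sU2X : U2 \subset X := subset_trans sU2 (fiber_sub b).
pose k := #|addset X1 (dil eps X)|.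
have le_k xi : (#|addset X1 (dil eps (fiber X Y xi))| <= k)%N.
  by apply/subset_leq_card/addsetS => //; apply/dilS/fiber_sub.
have le_s xi B0 : B0 \subset X -> (#|addset B0 (dil eps (fiber X Y xi))| <= s)%N.
  move=> sB0; apply: leq_trans leX; apply/subset_leq_card/addsetS => //.
  exact/dilS/fiber_sub.
have ne2 : (- eps) ^+ 2 = 1 by rewrite sqrrN.
pose Wc := fiber X Y c; pose Wd := fiber X Y d; pose Wa := fiber X Y a.
pose Ba := dil a U2; pose Bb := dil (- b) U2; pose Bd := dil (- d) X1.
have le_k_s : (k * #|U1| <= s * #|X1|)%N.
  apply: leq_trans leX1 _; rewrite leq_mul2r; apply/orP; right.
  by apply: leq_trans leX; apply/subset_leq_card/addsetS.
have p0 : (#|X1| * #|U2| * #|X1| <= k * #|addset (dil c X1) (addset Bd (addset Ba Bb))|)%N.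
  rewrite -(card_unique_sums (z := z + eps)); last first.
    by apply: contra zU; apply/subsetP/diff_ratiosS.
  apply: (@leq_trans (#|addset (addset X1 (dil eps X)) (dil z U2)| * #|X1|)).
    rewrite leq_mul2r; apply/orP; right; rewrite -addsetA; apply/subset_leq_card.
    apply: addsetS => //; rewrite addrC; apply: subset_trans (dil_subset_add _ _ _) _.
    by apply: addsetS => //; apply: dilS.
  apply: leq_trans (petridis _ minX1) _; rewrite leq_mul2l; apply/orP; right.
  rewrite -(card_dil _ k0) dil_add dil_dil (mulrC _ z) ez addsetA.
  by apply/subset_leq_card/addsetS; apply: dil_subset_add.
have swap (U V T : {set F}) : addset U (addset V T) = addset V (addset U T).
  by rewrite !addsetA (addsetC U).
pose Q1 := dil (- eps * c) Wc; pose Q2 := dil (- eps * d) Wd; pose Q3 := dil (- eps * a) Wa.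
have p1 : (#|Wc| * #|addset (dil c X1) (addset Bd (addset Ba Bb))|
    <= k * #|addset Bd (addset Q1 (addset Ba Bb))|)%N.
  by rewrite (swap Bd Q1); apply: (cover_fiber (tau := - eps)); rewrite // le_k.
have p2 : (#|Wd| * #|addset Bd (addset Q1 (addset Ba Bb))| <= s * #|addset Ba (addset Q2 (addset Q1 Bb))|)%N.
  rewrite (swap Ba) (swap Ba Q1).
  by apply: (cover_fiber (tau := eps)); rewrite ?mulrN ?mulNr // le_s.
have p3 : (#|Wa| * #|addset Ba (addset Q2 (addset Q1 Bb))| <= s * #|addset Q3 (addset Q2 (addset Q1 Bb))|)%N.
  by apply: (cover_fiber (tau := - eps)); rewrite // le_s.
have sQ xi : dil (- eps * xi) (fiber X Y xi) \subset dil (-1) (dil eps Y).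
  by rewrite -dil_dil -(mulN1r eps) -dil_dil; do 2!apply: dilS; apply: dil_fiber.
have p4 : (#|addset Q3 (addset Q2 (addset Q1 Bb))| <=
   #|addset (addset (addset Y (dil eps Y)) (dil eps Y)) (dil eps Y)|)%N.
  rewrite addsetC (addsetC Q2) (addsetC Q1).
  apply: leq_trans (card_dil_le (-1) _); rewrite !dil_add.
  apply/subset_leq_card; do 3!(apply: addsetS; last exact: sQ).
  rewrite /Bb -(mulN1r b) -dil_dil; apply: dilS.
  by apply: subset_trans (dil_fiber b); apply: dilS.
have {p4} p4 : (#|addset Q3 (addset Q2 (addset Q1 Bb))| * #|Y| ^ 2 <= K * s ^ 3)%N.
  by apply: leq_trans smallY; rewrite leq_mul2r p4 orbT.
have x10 : (0 < #|X1|)%N by rewrite card_gt0.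
exact: (three_covers_arith x10 p0 le_k_s p1 p2 p3 p4 (richD aD) (richD cD) (richD dD)).
Qed.

End Bounds.

(** * A subfield inside the quotients of differences *)

Section Points.
Variable F : finFieldType.
Implicit Types (A B C W X Y Z S U V D G R : {set F}) (c d t xi z l u v : F).

Definition slope_points D X Y : {set F * F} :=
  [set w | [&& w.1 \in X, w.2 \in Y, w.1 != 0 & w.2 / w.1 \in D]].
Definition column D X v : {set F} := [set u in X | (u != 0) && (v / u \in D)].
Definition row D Y u : {set F} := [set v in Y | (u != 0) && (v / u \in D)].

Lemma card_points_columns D X Y :
  #|slope_points D X Y| = (\sum_(v in Y) #|column D X v|)%N.
Proof.
rewrite -card_pairs -[RHS](card_imset _ (can_inj (@swap_pairK _ _))).
apply: eq_card => -[u v]; rewrite !inE /=; apply/and4P/imsetP.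
  move=> [uX vY u0 uv]; exists (v, u) => //; by rewrite !inE /= vY uX u0.
by move=> [[v' u']]; rewrite !inE /= => /and4P[? ? ? ?] [-> ->].
Qed.

Lemma card_points_rows D X Y :
  #|slope_points D X Y| = (\sum_(u in X) #|row D Y u|)%N.
Proof.
by rewrite -card_pairs; apply: eq_card => -[u v]; rewrite !inE.
Qed.

Lemma card_points_fibers D X Y :
  #|slope_points D X Y| = (\sum_(xi in D) #|fiber X Y xi|)%N.
Proof.
rewrite -card_pairs -(@card_in_imset _ _ (fun w => (w.2 / w.1, w.1)) (slope_points D X Y)).
  apply: eq_card => -[xi u]; rewrite !inE /=; apply/imsetP/and4P.
    move=> [[u' v]]; rewrite !inE /= => /and4P[uX vY u0 uv] [-> ->].
    by rewrite uv uX u0 divfK.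
  move=> [xD uX u0 uY]; exists (u, xi * u); rewrite ?inE /= ?uX ?uY ?u0 ?mulfK //.
move=> [u v] [u' v']; rewrite !inE /= => /and4P[_ _ u0 _] _ [e1 e2].
by subst u'; move/(congr1 ( *%R^~ u)): e1; rewrite !divfK // => ->.
Qed.

(** There are at most |P| omitted terms, each below m / (4 |P|). *)
Lemma popular_part (I : finType) (P : {set I}) (f : I -> nat) m :
  (4 * \sum_(i in P | ~~ (m <= 4 * #|P| * f i)) f i <= m)%N.
Proof.
have [P0|P0] := posnP #|P|.
  by rewrite (cards0_eq P0) big1 // => i; rewrite inE.
rewrite -(leq_pmul2l P0) mulnA -[X in (_ <= X)%N]sum_nat_const big_distrr big_mkcondr /=.
apply: leq_sum => i iP; case: ifP => //; rewrite -ltnNge => /ltnW.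
by rewrite (mulnC #|P|).
Qed.

Lemma slope_pointsU D X Y X' Y' :
  (#|slope_points D X Y| <= #|slope_points D X' Y'| + #|slope_points D (X :\: X') Y|
     + #|slope_points D X' (Y :\: Y')|)%N.
Proof.
apply: leq_trans (leq_trans (leq_card_setU _ _) (leq_add (leq_card_setU _ _) (leqnn _))).
apply/subset_leq_card/subsetP=> -[u v]; rewrite !inE /= => /and4P[-> -> -> ->].
by case: (u \in X'); case: (v \in Y').
Qed.

Definition inverses D : {set F} := [set xi^-1 | xi in D].

Lemma mem_inverses D xi : (xi \in inverses D) = (xi^-1 \in D).
Proof.
apply/imsetP/idP => [[x xD ->]|xD]; first by rewrite invrK.
by exists xi^-1; rewrite ?invrK.
Qed.

Lemma card_fiber_inv X Y xi : xi != 0 -> #|fiber Y X xi^-1| = #|fiber X Y xi|.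
Proof.
move=> x0; rewrite -(card_imset (fiber X Y xi) (mulfI x0)); apply: eq_card => v.
rewrite inE; apply/and3P/imsetP.
  move=> [vY v0 vX]; exists (xi^-1 * v); last by rewrite mulVKf.
  by rewrite inE vX mulVKf // vY mulf_neq0 ?invr_eq0.
by move=> [u]; rewrite inE => /and3P[uX u0 uY] ->; rewrite uY mulKf // uX mulf_neq0.
Qed.

End Points.

(** Let R be the set of quotients of differences of D.  It is contained in that of
a large column, hence in that of the inverses of D; this one is contained in
that of a large row, hence again in R.  So slopes and inverse slopes have the
same quotients of differences; the chain passes through a subset D' of D, which
therefore has them too.  The threshold 2^12 comes from the additive stability of R, where
|U1| >= p / (4 y) and |U2| >= N p / (32 x y) are fed into
[shifted_ratio_bound]: 4^2 * 32 * 8 = 2^12. *)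
Lemma many_points_force_subfield (F : finFieldType) (eps : F) (X Y D : {set F}) (s K N : nat) :
  eps ^+ 2 = 1 -> (#|addset X (dil eps X)| <= s)%N -> (#|addset Y (dil eps Y)| <= s)%N ->
  small_quadrupling eps X s K -> small_quadrupling eps Y s K ->
  0 \notin D -> (forall xi, xi \in D -> (N <= 2 * #|fiber X Y xi|)%N) ->
  let p := #|slope_points D X Y| in
  (2 ^ 12 * K * s ^ 7 * (#|X| * #|Y|) < N ^ 4 * p ^ 3)%N ->
  exists (G V : {set F}) (u0 : F), [/\ GRing.divring_closed G, V \subset X, u0 != 0 /\ (forall u, u \in V -> u / u0 \in G),
    (p <= 2 * #|Y| * #|V|)%N &
    (#|V| ^ 2 * #|G| * (N ^ 4 * #|Y| ^ 2) <= 16 * K * s ^ 7 * (#|G| + #|V| ^ 2))%N].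
Proof.
move=> e2 leX leY smallX smallY D0 richD p bigp.
pose x := #|X|; pose y := #|Y|.
have p_gt0 : (0 < p)%N by case: p bigp => //; rewrite muln0 ltn0.
have [w wP] : exists w, w \in slope_points D X Y by apply/card_gt0P.
have x0 : (0 < x)%N by apply/card_gt0P; exists w.1; move: wP; rewrite inE => /and4P[].
have y0 : (0 < y)%N by apply/card_gt0P; exists w.2; move: wP; rewrite inE => /and4P[].
have pxy : (p <= x * y)%N.
  by rewrite -cardsX; apply/subset_leq_card/subsetP=> -[u v]; rewrite !inE => /and4P[-> ->].
pose Di := inverses D.
have richDi xi : xi \in Di -> (N <= 2 * #|fiber Y X xi|)%N.
  rewrite mem_inverses => xD; rewrite -(invrK xi) card_fiber_inv ?richD //.
  by apply: contraNneq D0 => <-.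
(* V' and V keep the ordinates and abscissas with at least a quarter of the average
   number of points, D' the slopes with at least a quarter of their points above V; the latter
   guarantees a large set U2 in the proof of additive stability. *)
pose V' := [set v in Y | (p <= 4 * y * #|column D X v|)%N].
pose V := [set u in X | (p <= 4 * x * #|row D V' u|)%N].
pose D' := [set xi in D | (#|fiber X Y xi| <= 4 * #|fiber V Y xi|)%N].
have sV' : V' \subset Y by apply/subsetP=> v; rewrite inE => /andP[].
have sV : V \subset X by apply/subsetP=> v; rewrite inE => /andP[].
have sD' : D' \subset D by apply/subsetP=> v; rewrite inE => /andP[].
have lost1 : (4 * #|slope_points D X (Y :\: V')| <= p)%N.
  rewrite card_points_columns; apply: leq_trans (popular_part Y (fun v => #|column D X v|) p).
  rewrite leq_mul2l /=; apply: eq_leq; apply: eq_bigl => v.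
  by rewrite !inE; case: (v \in Y) => //=; rewrite andbT.
have lost2 : (4 * #|slope_points D (X :\: V) V'| <= p)%N.
  rewrite card_points_rows; apply: leq_trans (popular_part X (fun u => #|row D V' u|) p).
  rewrite leq_mul2l /=; apply: eq_leq; apply: eq_bigl => v.
  by rewrite !inE; case: (v \in X) => //=; rewrite andbT.
have keep : (p <= 2 * #|slope_points D V V'|)%N.
  have := slope_pointsU D X Y X V'; have := slope_pointsU D X V' V V'.
  rewrite !setDv.
  have P0 U : #|slope_points D set0 U| = 0%N by apply: eq_card0 => ?; rewrite !inE.
  have P0' U : #|slope_points D U set0| = 0%N by apply: eq_card0 => ?; rewrite !inE andbF.
  by rewrite P0 P0' -/p; lia.
have cardV : (p <= 2 * y * #|V|)%N.
  apply: leq_trans keep _; rewrite -mulnA leq_mul2l /= mulnC -cardsX.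
  by apply/subset_leq_card/subsetP=> -[u v]; rewrite !inE => /and4P[-> /andP[-> _]].
have keepD' : (p <= 4 * #|slope_points D' X Y|)%N.
  have le1 : (#|slope_points D V V'| <= #|slope_points D V Y|)%N.
    apply/subset_leq_card/subsetP=> -[u v]; rewrite !inE => /and4P[-> vV' -> ->].
    by case/andP: vV' => ->.
  have := leq_trans keep (leq_mul (leqnn 2) le1).
  have := card_points_fibers D X Y; rewrite -/p !card_points_fibers.
  rewrite !(big_setID D' (A := D)) /= (setIidPr sD').
  have : (\sum_(xi in D') #|fiber V Y xi| <= \sum_(xi in D') #|fiber X Y xi|)%N.
    apply: leq_sum => xi _; apply/subset_leq_card/subsetP=> u; rewrite !inE.
    by move=> /andP[/andP[-> _] ->].
  have : (4 * \sum_(xi in D :\: D') #|fiber V Y xi| <= \sum_(xi in D :\: D') #|fiber X Y xi|)%N.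
    rewrite big_distrr /=; apply: leq_sum => xi; rewrite !inE => /andP[+ xD].
    by rewrite xD /= -ltnNge => /ltnW.
  move: (\sum_(xi in D') #|fiber X Y xi|)%N (\sum_(xi in D') #|fiber V Y xi|)%N.
  move: (\sum_(xi in D :\: D') #|fiber X Y xi|)%N (\sum_(xi in D :\: D') #|fiber V Y xi|)%N.
  by move=> *; lia.
have bigN : (2 ^ 12 * K * s ^ 7 < N ^ 4 * p ^ 2)%N.
  rewrite -(ltn_pmul2r (_ : 0 < x * y)%N) ?muln_gt0 ?x0 //.
  apply: leq_trans bigp _; rewrite (expnSr p 2) mulnA leq_mul2l pxy orbT //.
have large m b b' : (p <= 4 * m * b)%N -> (p <= 4 * m * b')%N ->
    (16 * K * s ^ 7 < b * b' * (N ^ 4 * m ^ 2))%N.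
  move=> pb pb'; rewrite ltnNge; apply/negP => small; move: bigN; rewrite ltnNge => /negP; apply.
  rewrite -[(p ^ 2)%N]mulnn; apply: (leq_mul_step (leq_mul pb pb') (u := (N ^ 4)%N)) => //.
  apply: (leq_mul_step small (u := 16%N)); first by ring.
  have : (16 * 16 <= 2 ^ 12)%N by rewrite -(expnD 2 4 4) leq_exp2l.
  move: (2 ^ 12)%N => m2 le_m2; apply: (leq_mul_step le_m2 (u := (K * s ^ 7)%N)); first by ring.
  by apply: eq_leq; ring.
pose R := diff_ratios D D.
have sub1 (B B' : {set F}) : B \subset X -> B' \subset X -> (p <= 4 * y * #|B|)%N ->
    (p <= 4 * y * #|B'|)%N -> R \subset diff_ratios B B'.
  move=> sB sB' pB pB'; apply/subsetP=> z zR; apply: contraTT (large _ _ _ pB pB') => zB.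
  by rewrite -leqNgt -(card_unique_sums zB); apply: (card_ratio_sum_le e2 leX smallY richD).
have sub2 (B B' : {set F}) : B \subset Y -> B' \subset Y -> (p <= 4 * x * #|B|)%N ->
    (p <= 4 * x * #|B'|)%N -> diff_ratios Di Di \subset diff_ratios B B'.
  move=> sB sB' pB pB'; apply/subsetP=> z zR; apply: contraTT (large _ _ _ pB pB') => zB.
  by rewrite -leqNgt -(card_unique_sums zB); apply: (card_ratio_sum_le e2 leY smallX richDi).
have col_ratios (E : {set F}) v : E \subset D -> diff_ratios (column E X v) (column E X v) \subset
    diff_ratios (inverses E) (inverses E).
  move=> sE; apply/subsetP=> z zc.
  have v0 : v != 0.
    case/diff_ratiosP: zc => [b [_ [_ [_ [[+ _] _ _ _]]]]]; rewrite inE => /and3P[_ b0 vb].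
    by apply: contraNneq D0 => v0; apply: (subsetP sE); rewrite v0 mul0r in vb.
  rewrite -[z]mulr1 -(mulfV v0); apply: diff_ratios_scale zc => // b;
    by rewrite inE mem_inverses invf_div => /and3P[].
have row_ratios (E : {set F}) u u' z : u != 0 -> u' != 0 ->
    z \in diff_ratios (row E Y u) (row E Y u') -> z * (u' / u) \in diff_ratios E E.
  by move=> u0 u'0; apply: diff_ratios_scale => // b; rewrite inE => /and3P[].
have [v1 v1Y bigcol] : exists2 v, v \in Y & (p <= 4 * y * #|column D' X v|)%N.
  have [v vY h] := exists_above_average (fun v => #|column D' X v|) y0; exists v => //.
  by apply: leq_trans keepD' _; rewrite -mulnA leq_mul2l card_points_columns h.
have [u1 u1X bigrow] : exists2 u, u \in X & (p <= 4 * x * #|row D' Y u|)%N.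
  have [u uX h] := exists_above_average (fun u => #|row D' Y u|) x0; exists u => //.
  by apply: leq_trans keepD' _; rewrite -mulnA leq_mul2l card_points_rows h.
have sub_col (E : {set F}) v : column E X v \subset X by apply/subsetP=> u; rewrite inE => /andP[].
have sub_row (E : {set F}) u : row E Y u \subset Y by apply/subsetP=> v; rewrite inE => /andP[].
have RDi' : R \subset diff_ratios (inverses D') (inverses D').
  exact: subset_trans (sub1 _ _ (sub_col _ _) (sub_col _ _) bigcol bigcol) (col_ratios _ _ sD').
have sDi' : inverses D' \subset Di by apply: imsetS.
have RDi : R \subset diff_ratios Di Di.
  by apply: subset_trans RDi' (diff_ratiosS _ _).
have DiD' : diff_ratios Di Di \subset diff_ratios D' D'.
  apply: subset_trans (sub2 _ _ (sub_row _ _) (sub_row _ _) bigrow bigrow) _.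
  have u10 : u1 != 0.
    move: bigrow; case/posnP: #|row D' Y u1| => [->|]; first by rewrite muln0 leqNgt p_gt0.
    by case/card_gt0P=> v; rewrite inE => /and3P[].
  by apply/subsetP=> z /(row_ratios _ _ _ _ u10 u10); rewrite divff // mulr1.
have RD' : R \subset diff_ratios D' D' by apply: subset_trans RDi DiD'.
have DiR : diff_ratios Di Di \subset R.
  by apply: subset_trans DiD' (diff_ratiosS _ _).
have V0 u : u \in V -> u != 0.
  rewrite inE => /andP[_]; case/posnP: #|row D V' u| => [->|].
    by rewrite muln0 leqNgt p_gt0.
  by case/card_gt0P=> v + _; rewrite inE => /and3P[].
(* the numerator is taken from the points above u, the denominator from those
   above u' *)
have mulR u u' z : u \in V -> u' \in V -> z \in R -> z * (u' / u) \in R.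
  move=> uV u'V zR; apply: row_ratios; rewrite ?V0 //.
  have bigV w0 : w0 \in V -> (p <= 4 * x * #|row D Y w0|)%N.
    rewrite inE => /andP[_ h]; apply: leq_trans h _; rewrite leq_mul2l; apply/orP; right.
    by apply/subset_leq_card/subsetP=> v; rewrite !inE => /andP[/andP[-> _] ->].
  by apply: (subsetP (sub2 _ _ (sub_row _ _) (sub_row _ _) (bigV _ uV) (bigV _ u'V))); apply: (subsetP RDi).
(* z is represented with slopes of D'; the ordinate v is popular and its column
   meets the line of slope b in at least its average number of points *)
have addR z : z \in R -> z + eps \in R.
  move=> zR; apply: contraTT bigp => zeR; rewrite -leqNgt.
  case/diff_ratiosP: (subsetP RD' _ zR) => [a [b [c [d [[aD bD] [cD dD] cd ez]]]]].
  pose W := fiber V Y b.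
  have bigW : (N <= 8 * #|W|)%N.
    move: bD; rewrite inE => /andP[/richD h1 h2]; apply: leq_trans h1 _.
    by apply: (leq_mul_step h2 (u := 2%N)); rewrite // mulnA.
  have V'0 : (0 < #|V'|)%N.
    have : (0 < #|slope_points D V V'|)%N by case: posnP keep => // ->; rewrite leqNgt p_gt0.
    by case/card_gt0P=> -[u v]; rewrite inE => /and4P[_ vV' _ _]; apply/card_gt0P; exists v.
  have [v vV' lev] := exists_above_average (fun v => #|column D W v|) V'0.
  pose U1 := column D X v; pose U2 := column D W v.
  have sWX : W \subset X by apply: subset_trans (fiber_sub _ _ _) sV.
  have sU21 : U2 \subset U1.
    apply/subsetP=> u; rewrite /U2 /U1 in_set => /andP[uW uD].
    by rewrite in_set uD (subsetP sWX).
  have bigU2 : (#|W| * p <= 4 * x * y * #|U2|)%N.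
    apply: (@leq_trans (4 * x * (#|V'| * #|U2|))); last first.
      by rewrite -(mulnA (4 * x)%N) leq_mul2l leq_mul2r (subset_leq_card sV') !orbT.
    apply: leq_trans (leq_mul (leqnn _) lev); rewrite -card_points_columns card_points_rows.
    rewrite -sum_nat_const big_distrr /=; apply: leq_sum => u; rewrite inE => /andP[uV _].
    by move: uV; rewrite inE => /andP[].
  have bigU1 : (p <= 4 * y * #|U1|)%N by move: vV'; rewrite inE => /andP[].
  have U10 : U1 != set0.
    by rewrite -card_gt0; case: posnP bigU1 => // ->; rewrite muln0 leqNgt p_gt0.
  have zU : z + eps \notin diff_ratios U1 U2.
    apply: contra zeR => h; apply: (subsetP DiR); apply: (subsetP (col_ratios D v (subxx _))).
    exact: (subsetP (diff_ratiosS (subxx _) sU21)).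
  have sU2 : U2 \subset fiber X Y b.
    apply/subsetP=> u; rewrite !inE => /andP[/and3P[/andP[-> _] -> ->] _] //.
  have bound := shifted_ratio_bound e2 leX smallY richD (sub_col D v) U10 sU2.
  have {}bound : (#|U1| ^ 2 * #|U2| * N ^ 3 * y ^ 2 <= 8 * K * s ^ 7)%N.
    apply: (bound z) => //; exists a, c, d; split=> //; exact: (subsetP sD').
  have bigU2' : (N * p <= 32 * (x * y) * #|U2|)%N.
    apply: (leq_mul_step bigW (u := p)); first by ring.
    by apply: (leq_mul_step bigU2 (u := 8%N)); [|apply: eq_leq]; ring.
  have sq : (p ^ 2 <= 16 * y ^ 2 * #|U1| ^ 2)%N.
    by rewrite -mulnn; apply: leq_trans (leq_mul bigU1 bigU1) _; apply: eq_leq; ring.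
  apply: (leq_mul_step (leq_mul sq bigU2') (u := (N ^ 3)%N)); first by ring.
  apply: (leq_mul_step bound (u := (16 * 32 * (x * y))%N)); first by ring.
  by apply: eq_leq; rewrite /x /y; move: #|X| #|Y| => ? ?; ring.
(* with a single slope there are too few points *)
have R0 : 0 \in R.
  have [d dD] : exists d, d \in D.
    by exists (w.2 / w.1); move: wP; rewrite inE => /and4P[].
  have [c /andP[cD cd]|noc] := pickP (fun c => (c \in D) && (c != d)).
    by apply/diff_ratiosP; exists d, d, c, d; split=> //; rewrite mul0r subrr.
  have leX' : (#|fiber X Y d| <= x)%N by apply/subset_leq_card/fiber_sub.
  have px : (p <= x)%N.
    apply: leq_trans leX'; rewrite /p card_points_fibers (bigD1 d) //= big1 ?addn0 //.
    by move=> c; rewrite noc.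
  have Nx : (N <= 2 * x)%N by have h := richD d dD; apply: leq_trans h _; rewrite leq_mul2l leX'.
  have xs : (x <= s)%N.
    apply: leq_trans leX; apply: leq_card_addsetl.
    by case/card_gt0P: x0 => u uX; apply/set0Pn; exists (eps * u); apply: mem_dil.
  have K0 : (0 < K)%N.
    case: posnP (smallX) => // ->; rewrite /small_quadrupling mul0n leqn0 muln_eq0 expn_eq0.
    rewrite (gtn_eqF x0) orbF cards_eq0 => /eqP q0; case/card_gt0P: x0 => u uX.
    suff : u + eps * u + eps * u + eps * u \in (set0 : {set F}) by rewrite inE.
    by rewrite -q0; do !apply: mem_addset => //; apply: mem_dil.
  case/negP: (negbT (ltn_geF bigp)).
  apply: (@leq_trans ((2 * x) ^ 4 * x ^ 3)); first by rewrite leq_mul ?leq_exp2r.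
  rewrite expnMn -mulnA -expnD; apply: (@leq_trans (2 ^ 4 * s ^ 7)).
    by rewrite leq_mul2l leq_exp2r.
  rewrite -(mulnA (2 ^ 12)%N) -(mulnA (2 ^ 12)%N) leq_mul // ?leq_exp2l //.
  by rewrite mulnAC leq_pmull // !muln_gt0 K0 x0 y0.
have [u0 u0V] : exists u, u \in V.
  by apply/card_gt0P; move: cardV; case: #|V| => //; rewrite muln0 leqNgt p_gt0.
have [||G [fieldG GR VG]] := stabilizer_field e2 R0 addR (L := [set u / u0 | u in V]).
- by move=> _ z /imsetP[u uV ->] zR; rewrite mulrC mulR.
- by apply/imsetP=> -[u uV] /esym/eqP; rewrite mulf_eq0 invr_eq0 !(negPf (V0 _ _)).
exists G, V, u0; split=> //.
- by split=> [|u uV]; [apply: V0|apply: (subsetP VG); apply: imset_f].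
have G0 : (0 < #|G|)%N by apply/card_gt0P; exists 1; case: fieldG.
have [r rG ler] := few_collisions V G0.
apply: (@leq_trans (#|addset V (dil r V)| * (#|G| + #|V| ^ 2) * (N ^ 4 * #|Y| ^ 2))).
  by rewrite leq_mul2r ler orbT.
rewrite mulnAC leq_mul2r; apply/orP; right.
by apply: (card_ratio_sum_le e2 leX smallY richD) => //; apply: (subsetP GR).
Qed.

(** * The combinatorial dichotomy *)

Section Translate.
Variable F : finFieldType.
Implicit Types (A B C W X Y Z S U V D G R : {set F}) (c d t u v eps : F).

Lemma addset_shift A B a b :
  addset (addset A [set a]) (addset B [set b]) = addset (addset A B) [set a + b].
Proof.
have -> : [set a + b] = addset [set a] [set b].
  apply/setP=> z; rewrite inE; apply/eqP/imset2P => [->|[_ _ /set1P-> /set1P->] //].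
  by exists a b; rewrite ?set11.
by rewrite !addsetA (addsetAC A B).
Qed.

Lemma dil_shift c A a : dil c (addset A [set a]) = addset (dil c A) [set c * a].
Proof. by rewrite dil_add /dil imset_set1. Qed.

Lemma card_translate t X : #|translate t X| = #|X|.
Proof. exact: card_addset1. Qed.

Lemma card_doubling_translate eps t X :
  #|addset (translate t X) (dil eps (translate t X))| = #|addset X (dil eps X)|.
Proof. by rewrite /translate dil_shift addset_shift card_addset1. Qed.

Lemma small_quadrupling_translate eps t X s K :
  small_quadrupling eps X s K -> small_quadrupling eps (translate t X) s K.
Proof.
by rewrite /small_quadrupling /translate dil_shift !addset_shift !card_addset1.
Qed.

End Translate.

(** The combinatorial outcome.  Here x and y are the sides of the extremal grid,
N the approximate number of points on the chosen lines, T the number of triples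
in the extremal grid and v the number of popular abscissas.  The constant is existential so that it is
never evaluated as a natural number. *)
Lemma collinear_dichotomy : exists K : nat, forall (F : finFieldType) (A : {set F}) (eps : F),
  eps ^+ 2 = 1 -> (1 < #|A|)%N ->
  let a := #|A| in let s := #|addset A (dil eps A)| in let t := collinear_sextuples A in
  (t <= 131 * a ^ 4)%N \/
  exists x y N p T : nat, [/\ [&& x <= a, y <= a, 0 < x, 0 < y, p <= x * y & N <= 2 * x]%N,
    (t ^ 2 * (x * y) ^ 3 <= 144 * T ^ 2 * a ^ 6)%N,
    (T <= trunc_log 2 a * (4 * N * (x * y) * p))%N &
    (N ^ 4 * p ^ 3 <= 2 ^ 12 * K * s ^ 7 * (x * y))%N \/
    exists (G : {set F}) c d v, [/\ GRing.divring_closed G,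
      (v <= #|A :&: affine_image c d G|)%N, (p <= 2 * y * v)%N &
      (v ^ 2 * #|G| * (N ^ 4 * y ^ 2) <= 16 * K * s ^ 7 * (#|G| + v ^ 2))%N]].
Proof.
exists ((2 ^ 8) ^ 3)%N => F A eps e2 a1 a s t.
have A0 : A != set0 by rewrite -card_gt0 ltnW.
have le_t : (t <= collinear_triples A A + 3 * a ^ 4)%N := sextuples_le A.
case: (special_pair A0 (leqnn s)) => [small|[X [Y [[sX sY] [x0 y0] smallX smallY bigXY]]]].
  left; apply: leq_trans le_t _; rewrite -[131%N]/(128 + 3)%N mulnDl; exact: leq_add.
have [small|large] := leqP (collinear_triples A A) (3 * a ^ 4).
  left; apply: leq_trans le_t _; apply: (@leq_trans (3 * a ^ 4 + 3 * a ^ 4)).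
    by rewrite leq_add2r.
  by rewrite -mulnDl leq_mul2r orbT.
move: ((2 ^ 8) ^ 3)%N smallX smallY => K smallX smallY.
have leXA := subset_leq_card sX; have leYA := subset_leq_card sY.
have [N N1 leT] := dyadic Y leXA a1.
have [x1 [y1 [D [x1X y1Y D0 richD leD]]]] := base_point x0 y0 N1.
pose X0 := translate x1 X; pose Y0 := translate y1 Y.
pose p := #|slope_points D X0 Y0|.
have pE : p = (\sum_(xi in D) #|fiber X0 Y0 xi|)%N by apply: card_points_fibers.
have bigT : (collinear_triples X Y <= trunc_log 2 a * (4 * N * (#|X| * #|Y|) * p))%N.
  apply: leq_trans leT _; rewrite leq_mul2l; apply/orP; right.
  by apply: leq_trans leD _; rewrite pE mulnA.
have bigt : (t ^ 2 * (#|X| * #|Y|) ^ 3 <= 144 * collinear_triples X Y ^ 2 * a ^ 6)%N.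
  apply: (@leq_trans ((2 * collinear_triples A A) ^ 2 * (#|X| * #|Y|) ^ 3)).
    rewrite leq_mul2r leq_exp2r //; apply/orP; right.
    by apply: leq_trans le_t _; rewrite mul2n -addnn leq_add2l ltnW.
  by apply: (leq_mul_step bigXY (u := 4%N)); [|apply: eq_leq]; ring.
have pxy : (p <= #|X| * #|Y|)%N.
  rewrite -(card_translate x1 X) -(card_translate y1 Y) -cardsX.
  by apply/subset_leq_card/subsetP=> -[u v]; rewrite !inE => /and4P[-> ->].
have [p0|p_gt0] := posnP p.
  left; move: bigT; rewrite p0 muln0 muln0 leqn0 => /eqP T0.
  move: bigt; rewrite T0 muln0 mul0n leqn0 muln_eq0 !expn_eq0 muln_eq0.
  by rewrite (gtn_eqF x0) (gtn_eqF y0) /= orbF => /andP[/eqP -> _].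
have Nx : (N <= 2 * #|X|)%N.
  move: p_gt0; rewrite pE lt0n sum_nat_eq0 => /forall_inPn[xi xD _].
  have /andP[h _] := richD xi xD; apply: leq_trans h _; rewrite leq_mul2l /=.
  by rewrite -(card_translate x1 X); apply/subset_leq_card/fiber_sub.
right; exists #|X|, #|Y|, N, p, (collinear_triples X Y); split=> //.
  by rewrite leXA leYA x0 y0 pxy Nx.
case: (leqP (N ^ 4 * p ^ 3) (2 ^ 12 * K * s ^ 7 * (#|X| * #|Y|))) => [|bigp]; first by left.
right.
have le_s (Z : {set F}) z : Z \subset A -> (#|addset (translate z Z) (dil eps (translate z Z))| <= s)%N.
  by move=> sZ; rewrite card_doubling_translate; apply/subset_leq_card/addsetS => //; apply: dilS.
have [] := many_points_force_subfield e2 (le_s X x1 sX) (le_s Y y1 sY) (small_quadrupling_translate x1 smallX)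
  (small_quadrupling_translate y1 smallY) D0 _ (_ : (2 ^ 12 * K * s ^ 7 * (#|X0| * #|Y0|) < N ^ 4 * p ^ 3)%N).
- by move=> xi /richD /andP[].
- by rewrite !card_translate.
move=> G [V [u0 [fieldG sV [u00 VG] bigV bound]]].
exists G, u0, x1, #|V|; rewrite -(card_translate y1 Y); split=> //.
rewrite -(card_addset1 V x1); apply/subset_leq_card/subsetP=> _ /imset2P[u _ uV /set1P -> ->].
rewrite inE; apply/andP; split.
  by apply: (subsetP sX); rewrite -mem_translate; apply: (subsetP sV).
apply/imsetP; exists (u / u0); first exact: VG.
by rewrite mulrC divfK.
Qed.

(** * Numerical form *)

Section RealBounds.
Variable R : realType.
Implicit Types (a s q x y N p T t L v g C K : R).

Lemma ler_mul_step (t a b u v : R) : 0 <= u -> a <= b -> t = u * a -> u * b <= v -> t <= v.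
Proof. by move=> u0 leab ->; apply: le_trans; apply: ler_wpM2l. Qed.

(** Since p <= w, the hypothesis on N controls N^4 p^4, which is what the fourth
power of the bound on T contains. *)
Lemma triples_le_sumset_term a s w N p T t L C : 0 <= t -> 0 < w -> 0 <= a -> 0 <= s -> 0 <= N -> 0 <= p ->
  0 <= L -> 0 <= T -> p <= w ->
  t ^+ 2 * w ^+ 3 <= 144%:R * T ^+ 2 * a ^+ 6 -> T <= L * (4%:R * N * w * p) ->
  N ^+ 4 * p ^+ 3 <= C * s ^+ 7 * w ->
  t ^+ 4 <= (144%:R ^+ 2 * 256%:R * C) * (L ^+ 4 * s ^+ 7 * a ^+ 12).
Proof.
move=> t0 w0 a0 s0 N0 p0 L0 T0 pw ht hT hN.
have T4 : T ^+ 4 <= 256%:R * C * L ^+ 4 * s ^+ 7 * w ^+ 6.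
  have h1 : T ^+ 4 <= (L * (4%:R * N * w * p)) ^+ 4 by rewrite lerXn2r ?nnegrE ?mulr_ge0 ?(ltW w0).
  apply: le_trans h1 _.
  apply: (ler_mul_step (u := 256%:R * L ^+ 4 * w ^+ 4 * p) _ hN); last 2 first.
  - by ring.
  - have C0 : 0 <= C * s ^+ 7 * w by apply: le_trans hN; rewrite mulr_ge0 ?exprn_ge0.
    apply: (ler_mul_step (u := 256%:R * L ^+ 4 * w ^+ 4 * (C * s ^+ 7 * w)) _ pw).
    + by apply: mulr_ge0 => //; rewrite !mulr_ge0 ?exprn_ge0 ?(ltW w0).
    + by ring.
    by rewrite le_eqVlt; apply/orP; left; apply/eqP; ring.
  - by rewrite !mulr_ge0 ?exprn_ge0 ?(ltW w0).
have w6 : 0 < w ^+ 6 by rewrite exprn_gt0.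
rewrite -(ler_pM2r w6).
have h2 : (t ^+ 2 * w ^+ 3) ^+ 2 <= (144%:R * T ^+ 2 * a ^+ 6) ^+ 2.
  by rewrite lerXn2r ?nnegrE ?mulr_ge0 ?exprn_ge0 ?(ltW w0) //.
apply: (@le_trans _ _ ((t ^+ 2 * w ^+ 3) ^+ 2)); first by rewrite le_eqVlt; apply/orP; left; apply/eqP; ring.
apply: le_trans h2 _.
apply: (ler_mul_step (u := 144%:R ^+ 2 * a ^+ 12) _ T4); rewrite ?mulr_ge0 ?exprn_ge0 //; first by ring.
by rewrite le_eqVlt; apply/orP; left; apply/eqP; ring.
Qed.

(** Here p enters only through the trivial bound p <= x y. *)
Lemma triples_le_field_term a s q x y N p T t L C : 0 <= t -> 0 < x -> 0 < y -> x <= a -> 0 <= s -> 0 <= q -> 0 <= N ->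
  0 <= p -> 0 <= L -> 0 <= T -> p <= x * y ->
  t ^+ 2 * (x * y) ^+ 3 <= 144%:R * T ^+ 2 * a ^+ 6 -> T <= L * (4%:R * N * (x * y) * p) ->
  q * (N ^+ 4 * y ^+ 2) <= C * s ^+ 7 ->
  t ^+ 4 * q <= (144%:R ^+ 2 * 256%:R * C) * (L ^+ 4 * s ^+ 7 * a ^+ 14).
Proof.
move=> t0 x0 y0 xa s0 q0 N0 p0 L0 T0 pw ht hT hq.
have w0 : 0 < x * y by rewrite mulr_gt0.
have a0 : 0 <= a by apply: le_trans xa; apply: ltW.
have C0 : 0 <= C * s ^+ 7 by apply: le_trans hq; rewrite !mulr_ge0 ?exprn_ge0 ?(ltW y0).
have h1 : T <= L * (4%:R * N * (x * y) * (x * y)).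
  by apply: le_trans hT _; do 2!apply: ler_wpM2l => //; rewrite ?mulr_ge0 ?(ltW x0) ?(ltW y0).
have T4 : T ^+ 4 * (q * y ^+ 2) <= 256%:R * L ^+ 4 * (x * y) ^+ 8 * (C * s ^+ 7).
  have h2 : T ^+ 4 <= (L * (4%:R * N * (x * y) * (x * y))) ^+ 4.
    by rewrite lerXn2r ?nnegrE ?mulr_ge0 ?(ltW x0) ?(ltW y0).
  apply: (le_trans (ler_wpM2r _ h2)); first by rewrite mulr_ge0 ?exprn_ge0 ?(ltW y0).
  apply: (ler_mul_step (u := 256%:R * L ^+ 4 * (x * y) ^+ 8) _ hq) => //; last by ring.
  by rewrite !mulr_ge0 ?exprn_ge0 ?(ltW x0) ?(ltW y0).
have z0 : 0 < (x * y) ^+ 6 * y ^+ 2 by rewrite mulr_gt0 ?exprn_gt0.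
rewrite -(ler_pM2r z0).
have h3 : (t ^+ 2 * (x * y) ^+ 3) ^+ 2 <= (144%:R * T ^+ 2 * a ^+ 6) ^+ 2.
  by rewrite lerXn2r ?nnegrE // ?mulr_ge0 ?exprn_ge0 ?(ltW x0) ?(ltW y0) ?sqr_ge0.
apply: (ler_mul_step (u := q * y ^+ 2) _ h3); rewrite ?mulr_ge0 ?exprn_ge0 ?(ltW y0) //; first by ring.
apply: (ler_mul_step (u := 144%:R ^+ 2 * a ^+ 12) _ T4); rewrite ?mulr_ge0 ?exprn_ge0 //; first by ring.
have xa2 : x ^+ 2 <= a ^+ 2 by rewrite lerXn2r ?nnegrE ?(ltW x0).
apply: (ler_mul_step (u := 144%:R ^+ 2 * 256%:R * L ^+ 4 * a ^+ 12 * (x ^+ 6 * y ^+ 8) * (C * s ^+ 7)) _ xa2).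
- by apply: mulr_ge0 => //; rewrite !mulr_ge0 ?exprn_ge0 ?(ltW x0) ?(ltW y0).
- by ring.
by rewrite le_eqVlt; apply/orP; left; apply/eqP; ring.
Qed.

(** Both N <= 2 x and the bound on p by the size v of a part of a subfield are
used once; the remaining factor x y is at most a^2. *)
Lemma triples_le_subfield_term a x y N p T t L v kappa : 0 < x -> 0 < y -> x <= a -> y <= a -> 0 <= N -> 0 <= t ->
  0 <= p -> 0 <= L -> 0 <= T -> N <= 2%:R * x -> 0 <= v -> p <= 2%:R * y * v -> v <= kappa ->
  t ^+ 2 * (x * y) ^+ 3 <= 144%:R * T ^+ 2 * a ^+ 6 -> T <= L * (4%:R * N * (x * y) * p) ->
  t <= 192%:R * L * kappa * a ^+ 4.
Proof.
move=> x0 y0 xa ya N0 t0 p0 L0 T0 Nx v0 pv vk ht hT.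
have a0 : 0 <= a by apply: le_trans xa; apply: ltW.
have k0 : 0 <= kappa by apply: le_trans vk.
have w0 : 0 < x * y by rewrite mulr_gt0.
have T1 : T <= 16%:R * L * (x * y) ^+ 2 * kappa.
  apply: le_trans hT _; apply: (@le_trans _ _ (L * (4%:R * (2%:R * x) * (x * y) * (2%:R * y * kappa)))).
    apply: ler_wpM2l => //; apply: ler_pM => //.
    - by rewrite !mulr_ge0 ?(ltW x0) ?(ltW y0).
    - by apply: ler_wpM2r; [exact: ltW | apply: ler_wpM2l].
    - by apply: le_trans pv _; apply: ler_wpM2l; rewrite ?mulr_ge0 ?(ltW y0).
  by rewrite le_eqVlt; apply/orP; left; apply/eqP; ring.
rewrite -(@ler_pXn2r _ 2) ?nnegrE // ?mulr_ge0 ?exprn_ge0 //.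
rewrite -(ler_pM2r (exprn_gt0 3 w0)); apply: le_trans ht _.
have T2 : T ^+ 2 <= (16%:R * L * (x * y) ^+ 2 * kappa) ^+ 2.
  by rewrite lerXn2r ?nnegrE ?mulr_ge0 ?exprn_ge0 ?(ltW x0) ?(ltW y0).
apply: (ler_mul_step (u := 144%:R * a ^+ 6) _ T2); rewrite ?mulr_ge0 ?exprn_ge0 //; first by ring.
have xya : x * y <= a * a by apply: ler_pM => //; apply: ltW.
apply: (ler_mul_step (u := 192%:R ^+ 2 * L ^+ 2 * kappa ^+ 2 * a ^+ 6 * (x * y) ^+ 3) _ xya).
- by rewrite !mulr_ge0 ?exprn_ge0 ?(ltW x0) ?(ltW y0).
- by ring.
by rewrite le_eqVlt; apply/orP; left; apply/eqP; ring.
Qed.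

End RealBounds.

Section Final.
Variable R : realType.

Lemma powR_root (b r : R) (m n : nat) : 0 <= b -> r * n%:R = m%:R -> (b `^ r) ^+ n = b ^+ m.
Proof. by move=> b0 e; rewrite -powR_mulrn ?powR_ge0 // -powRrM e powR_mulrn. Qed.

(** The crude constant 1 + Q avoids fourth roots of constants. *)
Lemma le_fourth_root (t Q z : R) : 0 <= t -> 0 <= Q -> 0 <= z -> t ^+ 4 <= Q * z ^+ 4 ->
  t <= (1 + Q) * z.
Proof.
move=> t0 Q0 z0 h; have Q1 : 1 <= 1 + Q by rewrite lerDl.
rewrite -(@ler_pXn2r _ 4) ?nnegrE ?mulr_ge0 ?addr_ge0 //; apply: le_trans h _.
rewrite exprMn; apply: ler_wpM2r; first exact: exprn_ge0.
by apply: le_trans (ler_eXnr _ Q1) => //; rewrite lerDr.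
Qed.

Lemma trunc_log_le_ln (a : nat) : (0 < a)%N -> (trunc_log 2 a)%:R <= (ln 2)^-1 * ln a%:R :> R.
Proof.
move=> a0; have l2 : 0 < ln (2 : R) by apply: ln_gt0; rewrite ltr1n.
rewrite mulrC ler_pdivlMr // mulrC mulr_natr -lnXn ?ltr0n // -natrX.
by rewrite ler_ln ?posrE ?ltr0n ?expn_gt0 // ler_nat trunc_logP.
Qed.

(** A subfield G gives the second outcome when |V|^2 is at most a multiple of |G|
and the third when the other term of the maximum bounds |V|.  The fourth can only
come from G = F, to which the hypothesis on A does not apply. *)
Lemma collinear_cases (K0 : R) : 0 < K0 -> exists C : R, 0 < C /\
  forall (F : finFieldType) (A : {set F}) (delta : R) (eps : F),
   eps ^+ 2 = 1 -> (2 <= #|A|)%N -> 0 < delta -> subfield_condition K0 delta A ->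
   let a : R := #|A|%:R in let s : R := #|addset A (dil eps A)|%:R in let q : R := #|F|%:R in
   let t : R := (collinear_sextuples A)%:R in let L : R := (trunc_log 2 #|A|)%:R in
   [\/ t <= C * a ^+ 4, t ^+ 4 <= C * (L ^+ 4 * s ^+ 7 * a ^+ 12),
       t <= C * L * (a `^ (1 - delta) * a ^+ 4) | t ^+ 4 * q <= C * (L ^+ 4 * s ^+ 7 * a ^+ 14)].
Proof.
move=> K0_gt0; have [K HK] := collinear_dichotomy.
pose c : R := 144%:R ^+ 2 * 256%:R.
pose C1 : R := c * (2%:R ^+ 12 * K%:R).
pose M : R := 16%:R * K%:R.
pose C2 : R := c * (4%:R * (M * (1 + K0 ^+ 2))).
pose C3 : R := 192%:R * K0.
pose C4 : R := c * (2%:R * M).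
pose C5 : R := c * (4%:R * (M * (1 + 1))).
have K_ge0 : 0 <= K%:R :> R by [].
have c0 : 0 <= c by rewrite mulr_ge0 ?exprn_ge0.
have M0 : 0 <= M by rewrite mulr_ge0.
have C10 : 0 <= C1 by rewrite !mulr_ge0 ?exprn_ge0.
have C20 : 0 <= C2 by rewrite !mulr_ge0 ?addr_ge0 ?exprn_ge0 // ltW.
have C30 : 0 <= C3 by rewrite !mulr_ge0 // ltW.
have C40 : 0 <= C4 by rewrite !mulr_ge0.
have C50 : 0 <= C5 by rewrite !mulr_ge0 ?addr_ge0.
exists (131%:R + C1 + C2 + C3 + C4 + C5); split.
  do 5!apply: ltr_wpDr => //.
move=> F A delta eps e2 a2 delta0 subA a s q t L.
set C := _ + C5.
have leC (D z w : R) : D <= C -> 0 <= z -> w <= D * z -> w <= C * z.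
  by move=> le z0 h; apply: le_trans h _; apply: ler_wpM2r.
have h131 : 0 <= 131%:R :> R by [].
have [lC0 lC1 lC2] : [/\ 131%:R <= C, C1 <= C & C2 <= C].
  by rewrite /C; move: (C1) (C2) (C3) (C4) (C5) C10 C20 C30 C40 C50 h131 => *; split; lra.
have [lC3 lC4 lC5] : [/\ C3 <= C, C4 <= C & C5 <= C].
  by rewrite /C; move: (C1) (C2) (C3) (C4) (C5) C10 C20 C30 C40 C50 h131 => *; split; lra.
have a0 : 0 <= a by []. have s0 : 0 <= s by []. have q0 : 0 <= q by [].
have t0 : 0 <= t by []. have L0 : 0 <= L by [].
have z12 : 0 <= L ^+ 4 * s ^+ 7 * a ^+ 12 by rewrite !mulr_ge0 ?exprn_ge0.
have z14 : 0 <= L ^+ 4 * s ^+ 7 * a ^+ 14 by rewrite !mulr_ge0 ?exprn_ge0.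
case: (HK F A eps e2 a2) => [small|[x [y [N [p [T [/and5P[xa ya x0 y0 /andP[pxy Nx]] bigt bigT alt]]]]]]].
  apply: Or41; apply: leC lC0 _ _; first exact: exprn_ge0.
  by rewrite -natrX -natrM ler_nat.
have rx0 : 0 < x%:R :> R by rewrite ltr0n.
have ry0 : 0 < y%:R :> R by rewrite ltr0n.
have rxa : x%:R <= a by rewrite ler_nat.
have rya : y%:R <= a by rewrite ler_nat.
have rpxy : p%:R <= x%:R * y%:R :> R by rewrite -natrM ler_nat.
have rNx : N%:R <= 2%:R * x%:R :> R by rewrite -natrM ler_nat.
have rt : t ^+ 2 * (x%:R * y%:R) ^+ 3 <= 144%:R * T%:R ^+ 2 * a ^+ 6.
  by rewrite -(ler_nat R) !(natrX, natrM) in bigt.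
have rT : T%:R <= L * (4%:R * N%:R * (x%:R * y%:R) * p%:R).
  by rewrite -(ler_nat R) !natrM in bigT; rewrite !mulrA in bigT *.
have rw0 : 0 < x%:R * y%:R :> R by rewrite mulr_gt0.
have generic D : N%:R ^+ 4 * p%:R ^+ 3 <= D * s ^+ 7 * (x%:R * y%:R) -> t ^+ 4 <= c * D * (L ^+ 4 * s ^+ 7 * a ^+ 12).
  by move=> h; apply: (triples_le_sumset_term t0 rw0 a0 s0 _ _ L0 _ rpxy rt rT h).
case: alt => [small|[G [d1 [d2 [v [fieldG leV pv bound]]]]]].
  apply: Or42; apply: leC lC1 z12 _; apply: generic.
  by rewrite -(ler_nat R) !(natrX, natrM) in small.
have rpv : p%:R <= 2%:R * y%:R * v%:R :> R by rewrite -!natrM ler_nat.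
pose g : R := #|G|%:R.
have g0 : 0 < g by rewrite ltr0n; apply/card_gt0P; exists 1; case: fieldG.
have rbound : v%:R ^+ 2 * g * (N%:R ^+ 4 * y%:R ^+ 2) <= M * s ^+ 7 * (g + v%:R ^+ 2).
  by rewrite -(ler_nat R) !(natrX, natrM, natrD) in bound.
(* then |G| dominates on the right of rbound and cancels *)
have small_part (k : R) : v%:R ^+ 2 <= k * g -> N%:R ^+ 4 * p%:R ^+ 3 <=
    4%:R * (M * (1 + k)) * s ^+ 7 * (x%:R * y%:R).
  move=> vk.
  have h1 : v%:R ^+ 2 * (N%:R ^+ 4 * y%:R ^+ 2) <= M * (1 + k) * s ^+ 7.
    rewrite -(ler_pM2r g0); apply: (@le_trans _ _ (M * s ^+ 7 * (g + v%:R ^+ 2))).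
      by apply: le_trans rbound; rewrite mulrAC.
    apply: (@le_trans _ _ (M * s ^+ 7 * (g + k * g))).
      by apply: ler_wpM2l; rewrite ?mulr_ge0 ?exprn_ge0 // lerD2l.
    by rewrite le_eqVlt; apply/orP; left; apply/eqP; ring.
  have h2 : p%:R ^+ 2 <= (2%:R * y%:R * v%:R) ^+ 2 :> R by rewrite lerXn2r ?nnegrE ?mulr_ge0.
  apply: (ler_mul_step (u := N%:R ^+ 4 * p%:R ^+ 2) _ rpxy); rewrite ?mulr_ge0 ?exprn_ge0 //; first by ring.
  apply: (ler_mul_step (u := N%:R ^+ 4 * (x%:R * y%:R)) _ h2); rewrite ?mulr_ge0 ?exprn_ge0 //; first by ring.
  apply: (ler_mul_step (u := 4%:R * (x%:R * y%:R)) _ h1); rewrite ?mulr_ge0 //; first by ring.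
  by rewrite le_eqVlt; apply/orP; left; apply/eqP; ring.
have [GT|GT] := boolP (G == setT).
  have gq : g = q by rewrite /g (eqP GT) cardsT.
  have [le_vg|lt_gv] := lerP (v%:R ^+ 2) g.
    apply: Or42; apply: leC lC5 z12 _; apply: generic.
    by apply: small_part; rewrite mul1r.
  apply: Or44; apply: leC lC4 z14 _.
  apply: (triples_le_field_term t0 rx0 ry0 rxa s0 q0 _ _ L0 _ rpxy rt rT) => //.
  have v0 : 0 < v%:R ^+ 2 :> R by apply: lt_trans lt_gv.
  rewrite -gq -(ler_pM2l v0); apply: (@le_trans _ _ (M * s ^+ 7 * (g + v%:R ^+ 2))).
    by rewrite (mulrA (v%:R ^+ 2) g).
  apply: (@le_trans _ _ (M * s ^+ 7 * (v%:R ^+ 2 + v%:R ^+ 2))).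
    by apply: ler_wpM2l; rewrite ?mulr_ge0 ?exprn_ge0 // lerD2r ltW.
  by rewrite le_eqVlt; apply/orP; left; apply/eqP; ring.
have properG : proper_subfield G by split=> //; rewrite properT.
have rv := subA G d1 d2 properG.
have {}rv : v%:R <= K0 * Num.max (g `^ (1 / 2)) (a `^ (1 - delta)).
  by apply: le_trans rv; rewrite ler_nat.
have [le_max|le_max] := leP (g `^ (1 / 2)) (a `^ (1 - delta)).
  rewrite (max_r le_max) in rv.
  apply: Or43; rewrite -mulrA; apply: leC lC3 _ _; first by rewrite !mulr_ge0 ?powR_ge0 ?exprn_ge0.
  have h := triples_le_subfield_term rx0 ry0 rxa rya (ler0n R N) t0 (ler0n R p) L0 (ler0n R T) rNx
    (ler0n R v) rpv rv rt rT.
  apply: le_trans h _.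
  by rewrite le_eqVlt; apply/orP; left; apply/eqP; rewrite /C3; ring.
rewrite (max_l (ltW le_max)) in rv.
apply: Or42; apply: leC lC2 z12 _; apply: generic; apply: small_part.
have := lerXn2r 2 _ _ rv; rewrite !nnegrE => h; apply: le_trans (h _ _) _ => //.
  by rewrite mulr_ge0 ?powR_ge0 // ltW.
rewrite exprMn (powR_root (m := 1)) ?expr1 ?(ltW g0) //.
by rewrite divfK // pnatr_eq0.
Qed.

Lemma collinear_bound_le (K0 : R) : 0 < K0 -> exists C : R, 0 < C /\
  forall (F : finFieldType) (A : {set F}) (delta : R) (eps : F),
   eps ^+ 2 = 1 -> (2 <= #|A|)%N -> 0 < delta -> subfield_condition K0 delta A ->
   (collinear_sextuples A)%:R <= C * collinear_bound delta A (addset A (dil eps A)).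
Proof.
move=> K0_gt0; have [C [C0 HC]] := collinear_cases K0_gt0.
have l2 : 0 < ln (2 : R) by apply: ln_gt0; rewrite ltr1n.
exists ((1 + C) * (ln 2)^-1); split; first by rewrite mulr_gt0 ?invr_gt0 // addr_gt0.
move=> F A delta eps e2 a2 delta0 subA.
have := HC F A delta eps e2 a2 delta0 subA; rewrite /collinear_bound; cbv zeta.
have les : #|A|%:R <= #|addset A (dil eps A)|%:R :> R.
  rewrite ler_nat; apply: leq_card_addsetl; rewrite -card_gt0 card_dil.
    exact: leq_trans a2.
  by apply/eqP=> eps0; move/eqP: e2; rewrite eps0 expr0n eq_sym oner_eq0.
have q_gt0 : 0 < #|F|%:R :> R by rewrite ltr0n; apply/card_gt0P; exists 0.
have a_ge2 : 2 <= #|A|%:R :> R by rewrite ler_nat.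
have L1 : 1 <= (trunc_log 2 #|A|)%:R :> R by rewrite ler1n trunc_log_gt0.
have leL : (trunc_log 2 #|A|)%:R <= (ln 2)^-1 * ln #|A|%:R :> R.
  by apply: trunc_log_le_ln; apply: leq_trans a2.
have t0 : 0 <= (collinear_sextuples A)%:R :> R by [].
move: les q_gt0 a_ge2 L1 leL t0.
move: (#|A|%:R : R) (#|addset A (dil eps A)|%:R : R) (#|F|%:R : R) ((trunc_log 2 #|A|)%:R : R)
  ((collinear_sextuples A)%:R : R) => a s q L t les q_gt0 a_ge2 L1 leL t0.
set M := Num.max _ _ => bound.
have a_gt0 : 0 < a by apply: lt_le_trans a_ge2.
have a_ge1 : 1 <= a by apply: le_trans a_ge2; rewrite ler1n.
have s_ge1 : 1 <= s by apply: le_trans les.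
have s0 : 0 <= s by apply: le_trans s_ge1.
have a0 : 0 <= a := ltW a_gt0.
have L0 : 0 <= L by apply: le_trans L1.
have conclude (z : R) : 0 <= z -> z <= M -> t <= (1 + C) * (L * z) ->
    t <= (1 + C) * (ln 2)^-1 * (ln a * M).
  move=> z0 zM h; apply: le_trans h _; rewrite -mulrA; apply: ler_wpM2l.
    by rewrite addr_ge0 // ltW.
  by rewrite mulrA; apply: ler_pM.
have root74 : (s `^ (7 / 4)) ^+ 4 = s ^+ 7 by apply: powR_root => //; rewrite divfK ?pnatr_eq0.
case: bound => bound.
- apply: (conclude (s `^ (7 / 4) * a ^+ 3)); rewrite ?mulr_ge0 ?powR_ge0 ?exprn_ge0 //.
    by rewrite /M !le_max lexx.
  have le_pow : a <= s `^ (7 / 4).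
    apply: le_trans les _; rewrite -{1}(powRr1 s0); apply: ler_powR => //; lra.
  apply: le_trans bound _; apply: ler_pM; rewrite ?exprn_ge0 ?(ltW C0) ?lerDr //.
  rewrite -[a ^+ 4]mul1r exprS; apply: ler_pM => //; first by rewrite mulr_ge0 ?exprn_ge0.
  by apply: ler_wpM2r; rewrite ?exprn_ge0.
- apply: (conclude (s `^ (7 / 4) * a ^+ 3)); rewrite ?mulr_ge0 ?powR_ge0 ?exprn_ge0 //.
    by rewrite /M !le_max lexx.
  apply: le_fourth_root; rewrite ?mulr_ge0 ?powR_ge0 ?exprn_ge0 ?(ltW C0) //.
  have -> : (L * (s `^ (7 / 4) * a ^+ 3)) ^+ 4 = L ^+ 4 * (s `^ (7 / 4)) ^+ 4 * a ^+ 12 by ring.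
  by rewrite root74.
- apply: (conclude (a `^ (5 - delta / 2))); rewrite ?powR_ge0 //.
    by rewrite /M !le_max lexx !orbT.
  apply: le_trans bound _; rewrite -mulrA; apply: ler_pM;
    rewrite ?mulr_ge0 ?powR_ge0 ?exprn_ge0 ?(ltW C0) ?lerDr //.
  apply: ler_wpM2l => //; rewrite -(powR_mulrn 4 a0) -powRD; last first.
    by rewrite (gt_eqF a_gt0) implybT.
  by apply: ler_powR => //; lra.
- apply: (conclude (s `^ (7 / 4) * a `^ (7 / 2) * q `^ (- (1 / 4)))); rewrite ?mulr_ge0 ?powR_ge0 //.
    by rewrite /M !le_max lexx !orbT.
  apply: le_fourth_root; rewrite ?mulr_ge0 ?powR_ge0 ?(ltW C0) //.
  have rootq : (q `^ (- (1 / 4))) ^+ 4 = q^-1.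
    rewrite powRN exprVn (powR_root (m := 1)) ?expr1 ?(ltW q_gt0) //.
    by rewrite divfK ?pnatr_eq0.
  have roota : (a `^ (7 / 2)) ^+ 4 = a ^+ 14 by apply: powR_root => //; lra.
  rewrite !exprMn root74 roota rootq -(ler_pM2r q_gt0).
  rewrite [X in _ <= X](_ : _ = C * (L ^+ 4 * s ^+ 7 * a ^+ 14)) //.
  by field; rewrite gt_eqF.
Qed.
End Final.

Theorem theorem3 (R : realType) (K : R) (K_gt0 : 0 < K) :
  exists C : R, 0 < C /\
    forall (F : finFieldType) (A : {set F}) (delta : R),
      0 \notin A -> (2 <= #|A|)%N -> 0 < delta ->
      subfield_condition K delta A ->
      (collinear_sextuples A)%:R <= C * collinear_bound delta A (sumset A) /\
      (collinear_sextuples A)%:R <= C * collinear_bound delta A (diffset A).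
Proof.
have [C [C0 HC]] := collinear_bound_le K_gt0; exists C; split=> // F A delta _ a2 d0 subA.
split.
  have -> : sumset A = addset A (dil 1 A) by rewrite dil1.
  by apply: HC => //; rewrite expr1n.
have -> : diffset A = addset A (dil (-1) A).
  apply/setP=> z; apply/imset2P/imset2P.
    by move=> [a b aA bA ->]; exists a (- 1 * b); rewrite ?mem_dil // mulN1r.
  by move=> [a _ aA /imsetP[b bA ->] ->]; exists a b; rewrite // mulN1r.
by apply: HC => //; rewrite sqrrN expr1n.
Qed.
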